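(* Let $\Omega=(a,b)$ be a finite open interval, $0<\alpha<1$ and $1\le p<\infty$. Suppose that $\alpha p<1$. Then $W^{1,p}(\Omega)\subset{}^{\pm}W^{\alpha,p}(\Omega)$ (for each of the signs $-$ and $+$). Hence $W^{1,p}(\Omega)\subset W^{\alpha,p}(\Omega)$ when $\alpha p<1$.
   Context: $W^{1,p}(\Omega)$ is the usual integer-order Sobolev space. For $0<\alpha<1$ and $\varphi\in C_0^\infty(\mathbb{R})$: ${}^{-}D^{\alpha}\varphi(x)=\frac{1}{\Gamma(1-\alpha)}\frac{d}{dx}\int_{-\infty}^x\frac{\varphi(y)}{(x-y)^{\alpha}}dy$ and ${}^{+}D^{\alpha}\varphi(x)=\frac{-1}{\Gamma(1-\alpha)}\frac{d}{dx}\int_x^{\infty}\frac{\varphi(y)}{(y-x)^{\alpha}}dy$. For $u\in L^1(\Omega)$, $v\in L^1_{loc}(\Omega)$ is the left (resp. right) weak fractional derivative of $u$, $v={}^{-}\mathcal{D}^{\alpha}u$ (resp. ${}^{+}\mathcal{D}^{\alpha}u$), if $\int_\Omega v\varphi\,dx=\int_\Omega u\,{}^{+}D^{\alpha}\tilde\varphi\,dx$ (resp. with ${}^{-}D^{\alpha}\tilde\varphi$) for all $\varphi\in C_0^\infty(\Omega)$, where $\tilde\varphi$ is the zero extension of $\varphi$ to $\mathbb{R}$. ${}^{\pm}W^{\alpha,p}(\Omega)=\{u\in L^p(\Omega): {}^{\pm}\mathcal{D}^{\alpha}u\in L^p(\Omega)\}$, and the symmetric space (distinct from the usual Sobolev-Slobodeckij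 space) is $W^{\alpha,p}(\Omega)={}^{-}W^{\alpha,p}(\Omega)\cap{}^{+}W^{\alpha,p}(\Omega)$. *)

(* Defs.v *)
From HB Require Import structures.
From mathcomp Require Import all_boot all_order all_algebra.
From mathcomp Require Import all_classical all_reals all_analysis.

Set Implicit Arguments.
Unset Strict Implicit.
Unset Printing Implicit Defensive.
Import Order.TTheory GRing.Theory Num.Theory.
Import numFieldNormedType.Exports.

Local Open Scope classical_set_scope.
Local Open Scope ring_scope.

(* A function on Omega is represented by a function R -> R whose values outside
   Omega are never used, and an element of a function space by any one of its
   (Borel measurable) representatives. *)

Section sobolev.
Context {R : realType}.
Local Notation mu := (@lebesgue_measure R).
Implicit Types (Omega : set R) (alpha p s x : R) (u v phi : R -> R).

Definition Gamma s : R := \int[mu]_(t in `]0, +oo[) (t `^ (s - 1) * expR (- t)).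

(* C_0^oo(Omega). As the support lies in Omega, phi is already equal to the zero
   extension to R of its restriction to Omega. *)
Definition test_function Omega : set (R -> R) :=
  [set phi | [/\ forall n x, derivable (derive1n n phi) x 1,
                 compact (closure [set x | phi x != 0]) &
                 closure [set x | phi x != 0] `<=` Omega]].

Definition Lp Omega p : set (R -> R) :=
  [set u | u \_ Omega \in Lfun mu p%:E].

Definition left_frac_derive alpha phi x : R :=
  (Gamma (1 - alpha))^-1 *
  derive1 (fun z => \int[mu]_(y in `]-oo, z[) (phi y / (z - y) `^ alpha)) x.

Definition right_frac_derive alpha phi x : R :=
  - (Gamma (1 - alpha))^-1 *
  derive1 (fun z => \int[mu]_(y in `]z, +oo[) (phi y / (y - z) `^ alpha)) x.

Definition weak_derive Omega u v : Prop :=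
  [/\ locally_integrable Omega u, locally_integrable Omega v &
      forall phi, test_function Omega phi ->
        \int[mu]_(x in Omega) (u x * derive1 phi x) =
        - \int[mu]_(x in Omega) (v x * phi x)].

Definition left_weak_frac_derive Omega alpha u v : Prop :=
  [/\ Lp Omega 1 u, locally_integrable Omega v &
      forall phi, test_function Omega phi ->
        \int[mu]_(x in Omega) (v x * phi x) =
        \int[mu]_(x in Omega) (u x * right_frac_derive alpha phi x)].

Definition right_weak_frac_derive Omega alpha u v : Prop :=
  [/\ Lp Omega 1 u, locally_integrable Omega v &
      forall phi, test_function Omega phi ->
        \int[mu]_(x in Omega) (v x * phi x) =
        \int[mu]_(x in Omega) (u x * left_frac_derive alpha phi x)].

Definition sobolev1 Omega p : set (R -> R) :=
  [set u | Lp Omega p u /\ exists2 v, weak_derive Omega u v & Lp Omega p v].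

Definition left_frac_sobolev Omega alpha p : set (R -> R) :=
  [set u | Lp Omega p u /\
           exists2 v, left_weak_frac_derive Omega alpha u v & Lp Omega p v].

Definition right_frac_sobolev Omega alpha p : set (R -> R) :=
  [set u | Lp Omega p u /\
           exists2 v, right_weak_frac_derive Omega alpha u v & Lp Omega p v].

Definition frac_sobolev Omega alpha p : set (R -> R) :=
  left_frac_sobolev Omega alpha p `&` right_frac_sobolev Omega alpha p.

End sobolev.

(* Main.v *)
Require Import Defs.
From HB Require Import structures.
From mathcomp Require Import all_boot all_order all_algebra.
From mathcomp Require Import all_classical all_reals all_analysis.
From mathcomp Require Import measurable_realfun.
From mathcomp Require Import ring lra.

Import Order.TTheory GRing.Theory Num.Theory.
Import numFieldNormedType.Exports.

Local Open Scope classical_set_scope.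
Local Open Scope ring_scope.

(* Let u be in W^{1,p}(a, b) with weak derivative v, and k(t) = t^{-alpha} on
   ]0, b - a[.  Cutting off near a shows that there is a constant C (in fact
   C = - u(a)) such that int u G' + int v G = C G(a) for every smooth G that
   vanishes near b.  For a test function phi, the correlation
   G(z) = int phi(z + t) k(t) dt is such a function, and the right fractional
   derivative of phi on ]a, b[ is - G' / Gamma(1 - alpha).  Hence, by Fubini,
   the left weak fractional derivative of u is
   (v * k - C k(. - a)) / Gamma(1 - alpha).  Since alpha p < 1, k is in L^p, and
   so is v * k by Jensen's inequality.  The right derivative is obtained by the
   reflection x -> - x. *)

(** The obstacle is non-locality: G(z) sees phi everywhere to the right of z, so G vanishes near b
    but in general not at a, and the definition of the weak derivative cannot be applied to G. This
    is the source of the boundary value C, which is obtained as a value of a linear functional,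
    without passing to a continuous representative of u. The term C k(. - a) behaves like (x -
    a)^{-alpha} at a, and alpha p < 1 is exactly what makes it p-integrable there. Truncating k
    makes it integrable on the whole line, so that translation invariance and Fubini's theorem apply
    to integrals over R. In Jensen's inequality the weight is |v|, of finite mass because v is
    p-integrable on a bounded interval, and the function averaged is a translate of the reflected
    kernel; what is then needed is the integrability of k^p. *)

Set Implicit Arguments.
Unset Strict Implicit.
Unset Printing Implicit Defensive.

(** * Smooth functions and test functions *)

Section smooth.
Context {R : realType}.
Implicit Types f g : R -> R.

(* Wrapped in a constructor so that unification never unfolds it. *)
Variant smooth f : Prop :=
  Smooth of forall n x, derivable (derive1n n f) x 1.

Lemma smooth_derivable f : smooth f -> forall x, derivable f x 1.
Proof. by move=> [/(_ 0%N)]. Qed.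

Lemma smooth_derive1 f : smooth f -> smooth (derive1 f).
Proof. by move=> [sf]; split=> n x; have := sf n.+1 x; rewrite derive1Sn. Qed.

Lemma smooth_of_derive1 f :
  (forall x, derivable f x 1) -> smooth (derive1 f) -> smooth f.
Proof. by move=> df [sf]; split=> -[|n] x; [exact: df|rewrite derive1Sn]. Qed.

Lemma derivable_continuous f : (forall x, derivable f x 1) -> continuous f.
Proof. by move=> df x; exact/differentiable_continuous/derivable1_diffP/df. Qed.

Lemma smooth_continuous f : smooth f -> continuous f.
Proof. by move=> /smooth_derivable; exact: derivable_continuous. Qed.

Lemma derivable_affine (k m x : R) : derivable (fun z => k * z + m) x 1.
Proof.
apply: derivableD; last exact: derivable_cst.
by apply: derivableM; [exact: derivable_cst|exact: derivable_id].
Qed.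

Lemma derive1_affine (k m x : R) : derive1 (fun z => k * z + m) x = k.
Proof.
rewrite derive1E deriveD; last exact: derivable_cst.
  by rewrite derive_cst addr0 deriveMl ?derive_id ?mulr1.
by apply: derivableM; [exact: derivable_cst|exact: derivable_id].
Qed.

Lemma derivable_comp_affine f (k m x : R) :
  derivable f (k * x + m) 1 -> derivable (fun z => f (k * z + m)) x 1.
Proof.
move=> df; apply/derivable1_diffP/differentiable_comp.
  exact/derivable1_diffP/derivable_affine.
exact/derivable1_diffP.
Qed.

Lemma derive1_comp_affine f (k m x : R) : derivable f (k * x + m) 1 ->
  derive1 (fun z => f (k * z + m)) x = derive1 f (k * x + m) * k.
Proof.
move=> df.
have dkm := @derivable_affine k m x.
rewrite [LHS](@derive1_comp _ (fun z => k * z + m) f x dkm df).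
by rewrite derive1_affine.
Qed.

Lemma derive1M f g x : derivable f x 1 -> derivable g x 1 ->
  derive1 (f \* g) x = derive1 f x * g x + f x * derive1 g x.
Proof.
move=> df dg; rewrite derive1E [LHS](deriveM df dg) -!derive1E.
by rewrite addrC; congr (_ + _); exact: mulrC.
Qed.

Lemma derive1D f g x : derivable f x 1 -> derivable g x 1 ->
  derive1 (f \+ g) x = derive1 f x + derive1 g x.
Proof. by move=> df dg; rewrite derive1E [LHS](deriveD df dg) -!derive1E. Qed.

(* The functions generated by smooth functions under the operations below form
   a class of derivable functions that is stable under derivation. *)
Inductive smooth_closure : (R -> R) -> Prop :=
| Smooth_base f : smooth f -> smooth_closure f
| Smooth_cst (c : R) : smooth_closure (fun=> c)
| Smooth_affine f k m :
    smooth_closure f -> smooth_closure (fun x => f (k * x + m))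
| Smooth_add f g :
    smooth_closure f -> smooth_closure g -> smooth_closure (f \+ g)
| Smooth_mul f g :
    smooth_closure f -> smooth_closure g -> smooth_closure (f \* g).

Lemma smooth_closure_derivable f x : smooth_closure f -> derivable f x 1.
Proof.
move=> sf; elim: sf x => {f}.
- by move=> f sf x; exact: smooth_derivable sf x.
- by move=> c x; exact: derivable_cst.
- by move=> f k m _ df x; exact: derivable_comp_affine.
- by move=> f g _ df _ dg x; exact: derivableD.
- by move=> f g _ df _ dg x; exact: derivableM.
Qed.

Lemma smooth_closure_derive1 f : smooth_closure f -> smooth_closure (derive1 f).
Proof.
elim=> {f}.
- by move=> f sf; exact/Smooth_base/smooth_derive1.
- move=> c; rewrite (_ : derive1 _ = fun=> 0); first exact: Smooth_cst.
  by apply/funext => x; rewrite derive1_cst.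
- move=> f k m sf sf'.
  rewrite (_ : derive1 _ = (fun x => derive1 f (k * x + m)) \* (fun=> k)).
    by apply: Smooth_mul; [exact: Smooth_affine|exact: Smooth_cst].
  apply/funext => x; rewrite derive1_comp_affine//.
  exact: smooth_closure_derivable.
- move=> f g sf sf' sg sg'; rewrite (_ : derive1 _ = derive1 f \+ derive1 g).
    exact: Smooth_add.
  by apply/funext => x; rewrite derive1D//; exact: smooth_closure_derivable.
- move=> f g sf sf' sg sg';
  rewrite (_ : derive1 _ = (derive1 f \* g) \+ (f \* derive1 g)).
    by apply: Smooth_add; exact: Smooth_mul.
  by apply/funext => x; rewrite derive1M//; exact: smooth_closure_derivable.
Qed.

Lemma smooth_closureP f : smooth_closure f -> smooth f.
Proof.
move=> sf; split=> n; elim: n f sf => [|n ih] f sf x.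
  exact: smooth_closure_derivable.
by rewrite derive1Sn; exact/ih/smooth_closure_derive1.
Qed.

Lemma smooth_cst (c : R) : smooth (fun=> c).
Proof. exact/smooth_closureP/Smooth_cst. Qed.

Lemma smooth_affine f k m : smooth f -> smooth (fun x => f (k * x + m)).
Proof. by move=> sf; exact/smooth_closureP/Smooth_affine/Smooth_base. Qed.

Lemma smoothD f g : smooth f -> smooth g -> smooth (f \+ g).
Proof.
by move=> sf sg; apply/smooth_closureP/Smooth_add; exact: Smooth_base.
Qed.

Lemma smoothM f g : smooth f -> smooth g -> smooth (f \* g).
Proof.
by move=> sf sg; apply/smooth_closureP/Smooth_mul; exact: Smooth_base.
Qed.

Lemma near_derive1 f g x : {near x, f =1 g} -> derive1 f x = derive1 g x.
Proof. by move=> fg; rewrite !derive1E; exact: near_eq_derive. Qed.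

Lemma derive1_eq0_lt f c x : (forall y, y < c -> f y = 0) -> x < c ->
  derive1 f x = 0.
Proof.
move=> f0 xc; rewrite (@near_derive1 _ (fun=> 0)) ?derive1_cst//.
by near=> y; apply: f0; near: y; exact: lt_nbhsl.
Unshelve. all: by end_near. Qed.

Lemma derive1_eq0_gt f c x : (forall y, c < y -> f y = 0) -> c < x ->
  derive1 f x = 0.
Proof.
move=> f0 xc; rewrite (@near_derive1 _ (fun=> 0)) ?derive1_cst//.
by near=> y; apply: f0; near: y; exact: lt_nbhsr.
Unshelve. all: by end_near. Qed.

Lemma continuous_bounded_segment f (a b : R) : continuous f ->
  exists2 M, 0 <= M & forall x, a <= x <= b -> `|f x| <= M.
Proof.
move=> cf; have [ab|ba] := leP a b; last first.
  by exists 0 => // x /andP[ax xb]; have := le_trans ax xb; rewrite leNgt ba.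
have cnf : {within `[a, b], continuous (fun x => `|f x|)}.
  by apply: continuous_subspaceT => x; apply: cvg_norm; exact: cf.
have [c _ cmax] := EVT_max ab cnf.
by exists `|f c| => // x xab; apply: cmax; rewrite in_itv.
Qed.

(** The topological support is traded for two points strictly inside the interval, which are easier
    to compute with. They are the least and the greatest point of the compact support; for the zero
    function the midpoint serves as both. *)
Lemma test_function_itvP (a b : R) f : a < b ->
  test_function `]a, b[ f <->
  smooth f /\ exists c d, [/\ a < c, d < b &
    (forall x, x < c -> f x = 0) /\ (forall x, d < x -> f x = 0)].
Proof.
move=> ab; split.
  move=> [sf cK Kab]; split; first exact: Smooth.
  set K := closure _ in cK Kab.
  have [K0|/set0P K0] := eqVneq K set0.
    have f0 x : f x = 0.
      apply: contrapT => /eqP fx0.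
      have : K x by exact: (@subset_closure _ [set x | f x != 0] x).
      by rewrite K0.
    by exists ((a + b) / 2), ((a + b) / 2); split; [lra|lra|by split].
  have cid : {within K, continuous (@id R)}
    by apply: continuous_subspaceT => x; exact: cvg_id.
  have [c Kc cmin] := compact_EVT_min K0 cK cid.
  have [d Kd dmax] := compact_EVT_max K0 cK cid.
  have /Kab := set_mem Kc; rewrite /= in_itv/= => /andP[ac _].
  have /Kab := set_mem Kd; rewrite /= in_itv/= => /andP[_ db].
  exists c, d; split=> //; split=> x xcd; apply: contrapT => /eqP fx0.
    have /cmin : x \in K
      by exact/mem_set/(@subset_closure _ [set x | f x != 0] x).
    by rewrite leNgt xcd.
  have /dmax : x \in K
    by exact/mem_set/(@subset_closure _ [set x | f x != 0] x).
  by rewrite leNgt xcd.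
move=> [[sf] [c [d [ac db [fc fd]]]]].
have scd : closure [set x | f x != 0] `<=` `[c, d].
  rewrite closureE; apply: smallest_sub; first exact: itv_closed.
  move=> x /= fx0; rewrite in_itv/=; apply/andP; split.
    by rewrite leNgt; apply: contra fx0 => /fc ->.
  by rewrite leNgt; apply: contra fx0 => /fd ->.
split=> //.
  apply: subclosed_compact scd; first exact: closed_closure.
  exact: segment_compact.
apply: (subset_trans scd); apply: subset_itvSoo; rewrite bnd_simp//.
Qed.

End smooth.

(** * Smooth cutoff functions *)

Section cutoff.
Context {R : realType}.
Local Notation mu := (@lebesgue_measure R).
Implicit Types f g : R -> R.

Lemma is_derive_derive1 f x : derivable f x 1 -> is_derive x 1 f (derive1 f x).
Proof. by move=> df; rewrite derive1E; exact: derivableP. Qed.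

Lemma MVT_derive1 f (x y : R) : (forall z, derivable f z 1) -> x <= y ->
  exists2 z, x <= z <= y & f y - f x = derive1 f z * (y - x).
Proof.
move=> df xy; have [||z zxy fxy] := @MVT_segment R f (derive1 f) x y xy.
- by move=> z _; exact: is_derive_derive1.
- exact/continuous_subspaceT/derivable_continuous.
- by exists z => //; move: zxy; rewrite in_itv.
Qed.

Lemma integrable_continuous_support f (c d : R) : continuous f ->
  (forall x, x < c -> f x = 0) -> (forall x, d < x -> f x = 0) ->
  mu.-integrable setT (EFin \o f).
Proof.
move=> cf fc fd; rewrite (_ : f = f \_ `[c, d]).
  rewrite -restrict_EFin; apply: (iffLR (integrable_mkcond _ _)) => //.
  apply: continuous_compact_integrable; first exact: segment_compact.
  exact: continuous_subspaceT.
apply/funext => x; rewrite patchE; case: ifPn => //.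
rewrite notin_setE/= in_itv/= => /negP; rewrite negb_and -!ltNge.
by move=> /orP[/fc|/fd].
Qed.

(** A smooth step is obtained without an explicit bump function, as the normalised primitive of the
    square of the given test function. *)
Lemma cutoff_exists (a b x0 : R) f : a < b -> test_function `]a, b[ f ->
  f x0 != 0 ->
  exists H c d, [/\ a < c, d < b, smooth H,
    forall x, x < c -> H x = 0 & forall x, d < x -> H x = 1].
Proof.
move=> ab /(test_function_itvP _ ab)[sf [c [d [ac db [fc fd]]]]] fx0.
(* Squaring makes the integrand non-negative, so its primitive is nondecreasing and the total mass
   cannot cancel out. *)
pose g := f \* f.
have sg : smooth g by exact: smoothM.
have gc x : x < c -> g x = 0 by move=> /fc; rewrite /g/= => ->; rewrite mul0r.
have gd x : d < x -> g x = 0 by move=> /fd; rewrite /g/= => ->; rewrite mul0r.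
have ig : mu.-integrable setT (EFin \o g).
  exact: integrable_continuous_support (smooth_continuous sg) gc gd.
pose P x := \int[mu]_(t in `]-oo, x]) g t.
have dP x : derivable P x 1 /\ derive1 P x = g x.
  apply: (@continuous_FTC1 R g (BInfty _ true) x (x + 1)); rewrite ?ltrDl//.
    by apply: integrableS ig.
  by rewrite ltNyr.
  exact: (smooth_continuous sg).
have Pc x : x < c -> P x = 0.
  move=> xc; rewrite /P -[RHS](@Rintegral_set0 _ _ _ mu g).
  rewrite Rintegral_mkcond [RHS]Rintegral_mkcond; congr Rintegral.
  apply/funext => t; rewrite !patchE in_set0; case: ifPn => //.
  by rewrite inE/= in_itv/= => tx; apply: gc; exact: le_lt_trans xc.
have Pd x : d < x -> P x = \int[mu]_t g t.
  move=> dx; rewrite /P Rintegral_mkcond; congr Rintegral.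
  apply/funext => t; rewrite patchE; case: ifPn => //.
  rewrite notin_setE/= in_itv/= => /negP; rewrite -ltNge => xt.
  by rewrite gd// (lt_trans dx).
have Pnd x y : x <= y -> P x <= P y.
  move=> xy; rewrite -subr_ge0.
  have [z _ ->] := MVT_derive1 (fun z => (dP z).1) xy.
  by rewrite (dP z).2 mulr_ge0 ?subr_ge0// /g/= -expr2 sqr_ge0.
have x0b : x0 < b.
  by rewrite ltNge; apply: contra fx0 => bx0; rewrite fd// (lt_le_trans db).
(* If [P b] were 0, the monotone primitive [P] would vanish on the left of [b], and so would its
   derivative [g] at [x0]. *)
have Pb : P b != 0.
  apply: contra fx0 => /eqP Pb0; rewrite -[_ == 0]orbb -mulf_eq0.
  rewrite -[_ * _]/(g x0) -(dP x0).2 (@near_derive1 _ _ (fun=> 0)).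
    by rewrite derive1_cst.
  near=> x; have xb : x < b by near: x; exact: lt_nbhsl.
  apply/eqP; rewrite eq_le -{1}Pb0 Pnd ?(ltW xb)//=.
  have [xc|cx] := ltP x c; first by rewrite Pc.
  by rewrite -(Pc (c - 1)) ?Pnd//; lra.
pose H := (fun=> (P b)^-1) \* P.
exists H, c, d; split=> //.
- apply: smoothM; first exact: smooth_cst.
  apply: smooth_of_derive1 => [x|]; first exact: (dP x).1.
  by rewrite (_ : derive1 P = g)//; apply/funext => x; rewrite (dP x).2.
- by move=> x xc; rewrite /H/= (Pc x)// mulr0.
- by move=> x dx; rewrite /H/= (Pd x dx) -(Pd b db) mulVf.
Unshelve. all: by end_near. Qed.

End cutoff.

(** * Integration by parts with a boundary term *)

Section ibp.
Context {R : realType}.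
Local Notation mu := (@lebesgue_measure R).
Implicit Types (D : set R) (f g G : R -> R).

Lemma integrable_measurable_fun D f :
  mu.-integrable D (EFin \o f) -> measurable_fun D f.
Proof. by move=> fi; apply/measurable_EFinP; exact: measurable_int fi. Qed.

Lemma integrable_scale D f r : measurable D -> mu.-integrable D (EFin \o f) ->
  mu.-integrable D (EFin \o (fun x => r * f x)).
Proof.
move=> mD fi; rewrite (_ : _ \o _ = fun x => r%:E * (EFin \o f) x)%E.
  exact: integrableZl.
by apply/funext => x /=; rewrite EFinM.
Qed.

Lemma integrable_add D f g : measurable D ->
  mu.-integrable D (EFin \o f) -> mu.-integrable D (EFin \o g) ->
  mu.-integrable D (EFin \o (fun x => f x + g x)).
Proof.
move=> mD fi gi; rewrite (_ : _ \o _ = (EFin \o f) \+ (EFin \o g))%E//.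
exact: integrableD.
Qed.

Lemma integrableM_bounded D f g M : measurable D ->
  mu.-integrable D (EFin \o f) -> measurable_fun D g ->
  (forall x, D x -> `|g x| <= M) -> mu.-integrable D (EFin \o (f \* g)).
Proof.
move=> mD fi mg gM; rewrite (_ : _ \o _ = (EFin \o f) \* (EFin \o g))%E//.
apply: integrableMl => //; exists M; split; first exact: num_real.
by move=> y My x Dx /=; exact: le_trans (gM _ Dx) (ltW My).
Qed.

Lemma integrableM_continuous (a b : R) f g :
  mu.-integrable `]a, b[ (EFin \o f) -> continuous g ->
  mu.-integrable `]a, b[ (EFin \o (f \* g)).
Proof.
move=> fi cg; have [M _ gM] := continuous_bounded_segment a b cg.
apply: (@integrableM_bounded _ _ _ M) => //.
  by apply: measurable_funTS; exact: continuous_measurable_fun.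
by move=> x /=; rewrite in_itv/= => /andP[ax xb]; apply: gM; rewrite !ltW.
Qed.

Lemma dominated_cvg_Rintegral D f (g_ : nat -> R -> R) g M : measurable D ->
  mu.-integrable D (EFin \o f) ->
  (forall n, measurable_fun D (g_ n)) -> 0 <= M ->
  (forall n x, D x -> `|g_ n x| <= M) ->
  (forall x, D x -> g_ n x @[n --> \oo] --> g x) ->
  \int[mu]_(x in D) (f x * g_ n x) @[n --> \oo] -->
  \int[mu]_(x in D) (f x * g x).
Proof.
move=> mD fi mg_ M0 gM g_g.
have mf := integrable_measurable_fun fi.
have mg : measurable_fun D g.
  by apply: measurable_fun_cvg g_g.
have gM' x : D x -> `|g x| <= M.
  move=> Dx; have : `|g_ n x| @[n --> \oo] --> `|g x|.
    by apply: cvg_norm; exact: g_g.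
  by move=> /cvgr_to_le; apply; apply: nearW => n; exact: gM.
have fgi := integrableM_bounded mD fi mg gM'.
apply: fine_cvg; rewrite fineK; last exact: integrable_fin_num.
apply: (@dominated_cvg _ _ _ mu D mD (fun n x => (f x * g_ n x)%:E) _
  (fun x => M%:E * `|(f x)%:E|)%E).
- move=> n; apply/measurable_EFinP; apply: measurable_funM => //; exact: mg_.
- move=> x Dx; apply: cvg_EFin; first exact: nearW.
  by apply: cvgM; [exact: cvg_cst|exact: g_g].
- by move=> x Dx.
- by apply: integrableZl => //; exact: integrable_abse.
- by move=> n x Dx /=; rewrite lee_fin normrM mulrC ler_wpM2r// gM.
Qed.

Section weak_derivative.
Context (a b : R) (u v : R -> R).
Hypothesis ab : a < b.
Hypothesis ui : mu.-integrable `]a, b[ (EFin \o u).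
Hypothesis vi : mu.-integrable `]a, b[ (EFin \o v).
Hypothesis uv : forall phi, test_function `]a, b[ phi ->
  \int[mu]_(x in `]a, b[) (u x * derive1 phi x) =
  - \int[mu]_(x in `]a, b[) (v x * phi x).

(* The test functions [H (a + n (x - a)) * G x] converge boundedly to [G] on
   ]a, b[, and so do their derivatives because [G] vanishes at [a]. *)
Lemma weak_derive_vanishing (H G : R -> R) (c d d' : R) :
  a < c -> d < b -> smooth H ->
  (forall x, x < c -> H x = 0) -> (forall x, d < x -> H x = 1) ->
  d' < b -> smooth G -> G a = 0 -> (forall x, d' < x -> G x = 0) ->
  \int[mu]_(x in `]a, b[) (u x * derive1 G x) =
  - \int[mu]_(x in `]a, b[) (v x * G x).
Proof.
move=> ac db sH Hc Hd d'b sG Ga Gd'.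
pose k (n : nat) : R := n.+1%:R.
have k0 n : 0 < k n by rewrite ltr0n.
(* The dilation of centre [a] and ratio [k n] squeezes the transition zone of [H] into a layer of
   width of order 1/n at [a]. It is written as an affine map to fit [smooth_affine]. *)
pose z n x := k n * x + (a - k n * a).
have zE n x : z n x = a + k n * (x - a) by rewrite /z; ring.
pose G_ n := (fun x => H (z n x)) \* G.
have sHz n : smooth (fun x => H (z n x)) by exact: smooth_affine.
have sG_ n : smooth (G_ n) by exact: smoothM.
have dG_ n x :
    derive1 (G_ n) x = derive1 H (z n x) * k n * G x + H (z n x) * derive1 G x.
  rewrite derive1M; [|exact: smooth_derivable..].
  by rewrite derive1_comp_affine//; exact: smooth_derivable.
have tG_ n : test_function `]a, b[ (G_ n).
  apply/(test_function_itvP _ ab); split=> //.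
  exists (a + (c - a) / k n), d'; split=> //.
    by rewrite ltrDl divr_gt0// subr_gt0.
  split=> x xcd; rewrite /G_/=; last by rewrite Gd'// mulr0.
  rewrite Hc ?mul0r// zE -ltrBrDl mulrC -ltr_pdivlMr//.
  by rewrite ltrBlDl.
have z_gt n x : a < x -> a < z n x.
  by move=> ax; rewrite zE ltrDl mulr_gt0// subr_gt0.
(* At a fixed [x] the cutoff is eventually 1 and its derivative eventually 0, so both pointwise
   limits below are limits of eventually constant sequences. *)
have near_z x : a < x -> \forall n \near \oo, b < z n x.
  move=> ax; near=> n; rewrite zE -ltrBlDl -ltr_pdivrMr ?subr_gt0//.
  rewrite /k (@lt_le_trans _ _ n%:R) ?ler_nat//.
  by near: n; exact: nbhs_infty_gtr.
have [M0 M00 HM0] := continuous_bounded_segment a b (smooth_continuous sH).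
have HM n x : a < x -> `|H (z n x)| <= Num.max M0 1.
  move=> /(z_gt n) az; rewrite le_max; have [zb|bz] := leP (z n x) b.
    by rewrite HM0// (ltW az).
  by rewrite Hd ?normr1 ?lexx ?orbT// (lt_trans db).
have [M1 M10 HM1] :=
  continuous_bounded_segment a b (smooth_continuous (smooth_derive1 sH)).
have [M2 M20 GM2] := continuous_bounded_segment a b (smooth_continuous sG).
have [M3 M30 GM3] :=
  continuous_bounded_segment a b (smooth_continuous (smooth_derive1 sG)).
have H'd x : d < x -> derive1 H x = 0.
  move=> dx; rewrite (@near_derive1 _ _ (fun=> 1)) ?derive1_cst//.
  by near=> y; apply: Hd; near: y; exact: lt_nbhsr.
have GM x : a < x -> x < b -> `|G x| <= M3 * (x - a).
  move=> ax xb; rewrite -[G x]subr0 -Ga.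
  have [y /andP[ay yx] ->] :=
    MVT_derive1 (smooth_derivable sG) (ltW ax).
  rewrite normrM (ger0_norm (_ : 0 <= x - a)) ?subr_ge0 ?(ltW ax)//.
  by rewrite ler_wpM2r ?subr_ge0 ?(ltW ax)// GM3// ay (le_trans yx)// ltW.
(* The derivative of the dilated cutoff grows like [k n], but it is nonzero only where
   [k n * (x - a) <= b - a], and there [G x] is at most [M3 * (x - a)]: the two effects
   compensate. *)
have H'GM n x : a < x -> x < b ->
    `|derive1 H (z n x) * k n * G x| <= M1 * (M3 * (b - a)).
  move=> ax xb; have [zb|bz] := leP (z n x) b; last first.
    rewrite H'd ?(lt_trans db)// !mul0r normr0.
    by rewrite !mulr_ge0// subr_ge0 ltW.
  rewrite -mulrA normrM ler_pM// ?HM1 ?zb ?(ltW (z_gt _ _ _))//.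
  rewrite normrM (gtr0_norm (k0 n)) (@le_trans _ _ (k n * (M3 * (x - a))))//.
    by rewrite ler_wpM2l ?GM// ltW.
  rewrite mulrCA ler_wpM2l//.
  by move: zb; rewrite zE; lra.
have cu : \int[mu]_(x in `]a, b[) (u x * derive1 (G_ n) x) @[n --> \oo] -->
    \int[mu]_(x in `]a, b[) (u x * derive1 G x).
  apply: (@dominated_cvg_Rintegral _ _ _ _
    (M1 * (M3 * (b - a)) + Num.max M0 1 * M3)) => //.
  - move=> n; apply: measurable_funTS; apply: continuous_measurable_fun.
    exact/smooth_continuous/smooth_derive1.
  - apply: addr_ge0; first by rewrite !mulr_ge0// subr_ge0 ltW.
    by rewrite mulr_ge0// le_max M00.
  - move=> n x /=; rewrite in_itv/= => /andP[ax xb].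
    rewrite dG_ (le_trans (ler_normD _ _))// lerD ?H'GM//.
    by rewrite normrM ler_pM// ?HM ?GM3 ?(ltW ax) ?(ltW xb).
  - move=> x /=; rewrite in_itv/= => /andP[ax xb].
    apply: cvg_near_cst; near=> n; rewrite dG_.
    have bz : b < z n x by near: n; exact: near_z.
    by rewrite H'd ?Hd ?(lt_trans db)// !mul0r add0r mul1r.
have cv : \int[mu]_(x in `]a, b[) (v x * G_ n x) @[n --> \oo] -->
    \int[mu]_(x in `]a, b[) (v x * G x).
  apply: (@dominated_cvg_Rintegral _ _ _ _ (Num.max M0 1 * M2)) => //.
  - move=> n; apply: measurable_funTS; apply: continuous_measurable_fun.
    exact/smooth_continuous.
  - by rewrite mulr_ge0// le_max M00.
  - move=> n x /=; rewrite in_itv/= => /andP[ax xb].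
    by rewrite normrM ler_pM// ?HM ?GM2 ?(ltW ax) ?(ltW xb).
  - move=> x /=; rewrite in_itv/= => /andP[ax xb].
    apply: cvg_near_cst; near=> n.
    have bz : b < z n x by near: n; exact: near_z.
    by rewrite /G_/= Hd ?(lt_trans db)// mul1r.
move: cu; under eq_fun do rewrite uv//.
move=> cu; exact: (cvg_unique _ cu (cvgN cv)).
Unshelve. all: by end_near. Qed.

(** The linear functional [L] kills every admissible [G] with [G a = 0], so it is a multiple of
    evaluation at [a]. The multiple is its value on any function equal to 1 at [a] and to 0 near
    [b]. *)
Lemma weak_derive_boundary (phi0 : R -> R) (x0 : R) :
  test_function `]a, b[ phi0 -> phi0 x0 != 0 ->
  exists C, forall G d, d < b -> smooth G -> (forall x, d < x -> G x = 0) ->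
    \int[mu]_(x in `]a, b[) (u x * derive1 G x) +
    \int[mu]_(x in `]a, b[) (v x * G x) = C * G a.
Proof.
move=> tphi0 phi0x0.
have [H [c [d0 [ac d0b sH Hc Hd]]]] := cutoff_exists ab tphi0 phi0x0.
pose L (G : R -> R) := \int[mu]_(x in `]a, b[) (u x * derive1 G x) +
                      \int[mu]_(x in `]a, b[) (v x * G x).
(* This is [1 - H]: it is 1 near [a] and 0 near [b]. *)
pose G0 : R -> R := (fun=> 1) \+ ((fun=> -1) \* H).
have sG0 : smooth G0.
  by apply: smoothD; [exact: smooth_cst|apply: smoothM => //; exact: smooth_cst].
exists (L G0) => G d db sG Gd.
pose G1 := G \+ ((fun=> - G a) \* G0).
have sG1 : smooth G1.
  by apply: smoothD => //; apply: smoothM => //; exact: smooth_cst.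
have dG1 x : derive1 G1 x = derive1 G x + (- G a) * derive1 G0 x.
  rewrite derive1D ?derive1M ?derive1_cst ?mul0r ?add0r//;
    [exact: smooth_derivable|exact: smooth_derivable..|].
  by apply: smooth_derivable; apply: smoothM => //; exact: smooth_cst.
have G1a : G1 a = 0 by rewrite /G1 /G0/= Hc// mulr0 addr0 mulr1 subrr.
have G1d x : Num.max d d0 < x -> G1 x = 0.
  by rewrite gt_max /G1 /G0/= => /andP[/Gd -> /Hd ->]; ring.
have dd0b : Num.max d d0 < b by rewrite gt_max db d0b.
have := weak_derive_vanishing ac d0b sH Hc Hd dd0b sG1 G1a G1d.
have split_int (f g h : R -> R) : mu.-integrable `]a, b[ (EFin \o f) ->
    continuous g -> continuous h ->
    \int[mu]_(x in `]a, b[) (f x * (g x + (- G a) * h x)) =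
    \int[mu]_(x in `]a, b[) (f x * g x) +
    (- G a) * \int[mu]_(x in `]a, b[) (f x * h x).
  move=> fi cg ch.
  have fgi := integrableM_continuous fi cg.
  have fhi := integrableM_continuous fi ch.
  transitivity (\int[mu]_(x in `]a, b[) (f x * g x + (- G a) * (f x * h x))).
    by apply: eq_Rintegral => x _; ring.
  rewrite RintegralD ?RintegralZl//.
  exact: integrable_scale.
have cG := smooth_continuous sG; have cG0 := smooth_continuous sG0.
have cdG := smooth_continuous (smooth_derive1 sG).
have cdG0 := smooth_continuous (smooth_derive1 sG0).
under eq_Rintegral do rewrite dG1.
rewrite split_int// [X in _ = - X]split_int// => E.
have alg (r A B C D : R) :
    A + - r * C = - (B + - r * D) -> A + B = (C + D) * r.
  by move=> h; rewrite -[A](addrK (- r * C)) h; ring.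
exact: alg E.
Qed.

End weak_derivative.
End ibp.

(** * Invariance of the Lebesgue measure under translation and reflection *)

Section measure_preserving.
Context {R : realType}.
Local Notation mu := (@lebesgue_measure R).
Local Open Scope ereal_scope.

(** The change of variables for pushforward measures settles non-negative functions; positive and
    negative parts give the rest. *)
Lemma integral_measure_preserving
    (h : measurableTypeR R -> measurableTypeR R) (f : R -> \bar R) :
  measurable_fun setT h ->
  (forall A, measurable A -> mu (h @^-1` A) = mu A) ->
  measurable_fun setT f -> \int[mu]_x f (h x) = \int[mu]_x f x.
Proof.
move=> mh hmu mf.
have ge0 (g : R -> \bar R) : measurable_fun setT g -> (forall x, 0 <= g x) ->
    \int[mu]_x g (h x) = \int[mu]_x g x.
  move=> mg g0; transitivity (\int[pushforward mu h]_x g x).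
    by rewrite ge0_integral_pushforward// preimage_setT.
  by apply: eq_measure_integral => A mA _; exact: hmu.
rewrite integralE [RHS]integralE; congr (_ - _).
- transitivity (\int[mu]_x f^\+ (h x)); first by
    apply: eq_integral => x _; rewrite !funeposE.
  by apply: ge0 => //; exact: measurable_funepos.
- transitivity (\int[mu]_x f^\- (h x)); first by
    apply: eq_integral => x _; rewrite !funenegE.
  by apply: ge0 => //; exact: measurable_funeneg.
Qed.

(** The pushforward by a translation has the right value on half-open intervals, which determine the
    Lebesgue measure. *)
Lemma lebesgue_measure_addr (c : R) (A : set R) : measurable A ->
  mu ((fun x => x + c)%R @^-1` A) = mu A.
Proof.
have mc : measurable_fun setT
    ((fun x => x + c)%R : measurableTypeR R -> measurableTypeR R).
  exact: measurable_funD.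
pose m := [the measure _ _ of pushforward mu
  ((fun x => x + c)%R : measurableTypeR R -> measurableTypeR R)].
move=> mA; apply/esym/(@lebesgue_measure_unique R (m mc)) => //= _ [[x y]] _ <-.
rewrite /pushforward.
rewrite (_ : _ @^-1` _ = `]x - c, y - c]%classic)%R.
  by rewrite !lebesgue_measure_itv/= !lte_fin ltrD2r -!EFinB opprB addrA subrK.
by apply/seteqP; split => z /=; rewrite !in_itv/= ltrBlDr lerBrDr.
Qed.

Lemma integral_shift (c : R) (f : R -> \bar R) : measurable_fun setT f ->
  \int[mu]_x f (x + c)%R = \int[mu]_x f x.
Proof.
move=> mf; apply: (@integral_measure_preserving (fun x => x + c)%R) => //.
  exact: measurable_funD.
exact: lebesgue_measure_addr.
Qed.

Lemma lebesgue_integral_opp (f : R -> \bar R) : measurable_fun setT f ->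
  \int[mu]_x f (- x)%R = \int[mu]_x f x.
Proof.
move=> mf; apply: (@integral_measure_preserving -%R) => //.
exact: lebesgue_measureN.
Qed.

Lemma Rintegral_shift (c : R) (f : R -> R) : measurable_fun setT f ->
  (\int[mu]_x f (x + c) = \int[mu]_x f x)%R.
Proof.
move=> mf; congr fine; apply: (integral_shift _ (f := EFin \o f)).
exact/measurable_EFinP.
Qed.

Lemma Rintegral_opp (f : R -> R) : measurable_fun setT f ->
  (\int[mu]_x f (- x) = \int[mu]_x f x)%R.
Proof.
move=> mf; congr fine; apply: (lebesgue_integral_opp (f := EFin \o f)).
exact/measurable_EFinP.
Qed.

End measure_preserving.

(** * Integrability of powers *)

Section kernel.
Context {R : realType}.
Local Notation mu := (@lebesgue_measure R).

Lemma continuous_powR_inv (r x : R) : 0 < x ->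
  {for x, continuous (fun t => (t `^ r)^-1)}.
Proof.
move=> x0; apply: cvgV; first by rewrite gt_eqF// powR_gt0.
have [d _] := is_derive1_powR r x0.
by have /derivable1_diffP/differentiable_continuous := d.
Qed.

Lemma measurable_powR_inv (r : R) : measurable_fun setT (fun t => (t `^ r)^-1).
Proof.
rewrite (_ : (fun t => _) = (fun t => t `^ (- r))).
  exact: measurable_powR.
by apply/funext => t; rewrite powRN.
Qed.

(** The non-negative value of the primitive at [e] is dropped, which leaves a bound that survives
    the passage from [e] to 0. *)
Lemma integral_powR_inv_le (r e l : R) : r < 1 -> 0 < e -> e < l ->
  (\int[mu]_(t in `[e, l]) ((t `^ r)^-1)%:E <= (l `^ (1 - r) / (1 - r))%:E)%E.
Proof.
move=> r1 e0 el; have r0 : 0 < 1 - r by rewrite subr_gt0.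
have l0 := lt_trans e0 el.
pose F (t : R) := t `^ (1 - r) / (1 - r).
have dF (t : R) : 0 < t -> is_derive t 1 F (t `^ r)^-1.
  move=> t0; rewrite (_ : (t `^ r)^-1 =
      (1 - r)^-1 *: ((1 - r) * t `^ (1 - r - 1))); last first.
    by rewrite [RHS]mulrA mulVf ?gt_eqF// mul1r addrAC subrr add0r powRN.
  rewrite (_ : F = (1 - r)^-1 \*: (@powR R ^~ (1 - r))).
    by apply: is_deriveZ; exact: is_derive1_powR.
  by apply/funext => x; rewrite /F mulrC.
rewrite (@continuous_FTC2 _ _ F)//.
- by rewrite -EFinB lee_fin lerBlDr lerDl divr_ge0 ?powR_ge0// ltW.
- apply: continuous_in_subspaceT => t; rewrite inE/= in_itv/= => /andP[et _].
  by apply: continuous_powR_inv; exact: lt_le_trans et.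
- split.
  + move=> t; rewrite in_itv/= => /andP[et _].
    by have [] := dF t (lt_trans e0 et).
  + apply: cvg_at_right_filter.
    by have [/derivable1_diffP/differentiable_continuous] := dF e e0.
  + apply: cvg_at_left_filter.
    by have [/derivable1_diffP/differentiable_continuous] := dF l l0.
- move=> t; rewrite in_itv/= => /andP[et _].
  by rewrite derive1E; have [_ ->] := dF t (lt_trans e0 et).
Qed.

Lemma integrable_powR_inv (r l : R) : r < 1 ->
  mu.-integrable `]0, l[ (fun t => ((t `^ r)^-1)%:E).
Proof.
move=> r1; have [l0|l0] := leP l 0.
  by rewrite set_itv_ge ?bnd_simp -?leNgt//; exact: integrable_set0.
have mf D : measurable_fun D (fun t => ((t `^ r)^-1)%:E).
  apply/measurable_EFinP; apply: measurable_funTS; exact: measurable_powR_inv.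
have f0 (t : R) : (0 <= ((t `^ r)^-1)%:E)%E
  by rewrite lee_fin invr_ge0 powR_ge0.
apply/integrableP; split; first exact: mf.
apply: (@le_lt_trans _ _ (l `^ (1 - r) / (1 - r))%:E); last exact: ltry.
under eq_integral do rewrite gee0_abs//.
(* These intervals increase to []0, l]]; the denominator starts at 2 so that the left end is below
   [l] already for [n = 0]. *)
pose D n : set R := [set` `[l / n.+2%:R, l]].
have De : \bigcup_n D n = [set` `]0, l]].
  apply/seteqP; split => t /=.
    move=> [n _]; rewrite /D/= !in_itv/= => /andP[lt ->]; rewrite andbT.
    by apply: lt_le_trans lt; rewrite divr_gt0.
  rewrite in_itv/= => /andP[t0 tl].
  have tl0 : 0 < t / l by rewrite divr_gt0.
  have [n] := ltr_add_invr tl0; rewrite add0r => nt.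
  exists n => //; rewrite /D/= in_itv/= tl andbT ltW//.
  rewrite -ltr_pdivlMl// mulrC (le_lt_trans _ nt)// lef_pV2 ?posrE//.
  by rewrite ler_nat.
have nD : nondecreasing_seq D.
  move=> m n mn; rewrite subsetEset; apply: subset_itvr; rewrite bnd_simp.
  by rewrite ler_pM2l// lef_pV2 ?posrE// ler_nat.
apply: (@le_trans _ _ (\int[mu]_(t in `]0%R, l]) ((t `^ r)^-1)%:E)%E).
  apply: ge0_subset_integral => //; first exact: mf.
  by apply: subset_itvl; rewrite bnd_simp.
rewrite -De.
have := @ge0_nondecreasing_set_cvg_integral _ (measurableTypeR R) R D
  (fun t => ((t `^ r)^-1)%:E) mu nD.
move=> /(_ (fun=> measurable_itv _)) /(_ (fun=> mf _)) /(_ (fun _ _ _ => f0 _)).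
move=> cD; rewrite -(cvg_lim _ cD)//; apply: lime_le.
  by apply/cvg_ex; eexists; exact: cD.
apply: nearW => n; apply: integral_powR_inv_le => //.
  by rewrite divr_gt0.
by rewrite ltr_pdivrMr// ltr_pMr// ltr1n.
Qed.

End kernel.

(** * Correlation with the fractional kernel *)

Section correlation.
Context {R : realType}.
Local Notation mu := (@lebesgue_measure R).
Implicit Types (k phi : R -> R).

Lemma bounded_continuous_support phi (c d : R) : continuous phi ->
  (forall x, x < c -> phi x = 0) -> (forall x, d < x -> phi x = 0) ->
  exists2 M, 0 <= M & forall x, `|phi x| <= M.
Proof.
move=> cphi phic phid.
have [M M0 phiM] := continuous_bounded_segment c d cphi.
exists M => // x; have [xc|cx] := ltP x c; first by rewrite phic// normr0.
by have [dx|xd] := ltP d x; [rewrite phid// normr0|rewrite phiM// cx].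
Qed.

Definition correlation k phi z := \int[mu]_t (phi (z + t) * k t).

Lemma integrable_correlation k phi M z : mu.-integrable setT (EFin \o k) ->
  measurable_fun setT phi -> (forall x, `|phi x| <= M) ->
  mu.-integrable setT (EFin \o (fun t => phi (z + t) * k t)).
Proof.
move=> ik mphi phiM.
rewrite (_ : (fun t => _) = k \* (fun t => phi (z + t))).
  apply: (@integrableM_bounded _ _ _ _ M) => //.
  by apply: measurableT_comp => //; exact: measurable_funD.
by apply/funext => t; rewrite /= mulrC.
Qed.

(** The substitution [y = z + t] moves the parameter from [phi] to [k]. The definition is suited to
    differentiation in [z], this form to Fubini's theorem. *)
Lemma correlationE k phi z : measurable_fun setT k -> measurable_fun setT phi ->
  correlation k phi z = \int[mu]_y (phi y * k (y - z)).
Proof.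
move=> mk mphi; rewrite -[RHS](Rintegral_shift z).
  by apply: eq_Rintegral => t _; rewrite addrK addrC.
apply: measurable_funM => //; apply: measurableT_comp => //.
exact: measurable_funB.
Qed.

(** The kernel is merely integrable, so the derivative is put on [phi]. Differentiation under the
    integral is dominated by [M * |k|], where [M] bounds the derivative of [phi]. *)
Lemma derive_correlation k phi (c d x : R) : mu.-integrable setT (EFin \o k) ->
  smooth phi ->
  (forall x, x < c -> phi x = 0) -> (forall x, d < x -> phi x = 0) ->
  derivable (correlation k phi) x 1 /\
  derive1 (correlation k phi) x = correlation k (derive1 phi) x.
Proof.
move=> ik sphi phic phid.
have [M0 M00 phiM] :=
  bounded_continuous_support (smooth_continuous sphi) phic phid.
have [M M0' dphiM] := bounded_continuous_support
  (smooth_continuous (smooth_derive1 sphi))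
  (fun x => derive1_eq0_lt phic (x := x))
  (fun x => derive1_eq0_gt phid (x := x)).
have mphi : measurable_fun setT phi.
  by apply: continuous_measurable_fun; exact: smooth_continuous.
pose f (z t : R) := phi (z + t) * k t.
have df (z t : R) : is_derive z 1 (f ^~ t) (derive1 phi (z + t) * k t).
  have := derivable_comp_affine (k := 1) (m := t) (x := z) (f := phi).
  have := derive1_comp_affine (k := 1) (m := t) (x := z) (f := phi).
  rewrite mul1r mulr1 (_ : (fun z => phi (1 * z + t)) = fun z => phi (z + t)).
    have dphi : derivable phi (z + t) 1 by exact: smooth_derivable.
    move=> /(_ dphi) E /(_ dphi) D.
    rewrite -E derive1E mulrC.
    rewrite (_ : f ^~ t = k t \*: (fun z => phi (z + t))).
      exact: (is_deriveZ (k t) (derivableP D)).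
    by apply/funext => y; rewrite /f mulrC.
  by apply/funext => y; rewrite mul1r.
(* The domination is uniform in [z], so the radius 1 is arbitrary. *)
have xI : `]x - 1, x + 1[%classic x
  by rewrite /= in_itv/= ltrDl ltrBlDr ltrDl ltr01.
have intf z : `]x - 1, x + 1[%classic z -> mu.-integrable setT (EFin \o f z).
  by move=> _; exact: integrable_correlation ik mphi phiM.
have derf z t : `]x - 1, x + 1[%classic z -> setT t -> derivable (f ^~ t) z 1.
  by move=> _ _; have [] := df z t.
have G0 t : 0 <= M * `|k t| by rewrite mulr_ge0.
have iG : mu.-integrable setT (EFin \o (fun t => M * `|k t|)).
  by apply: integrable_scale => //; exact: integrable_norm.
have dfG z t : `]x - 1, x + 1[%classic z -> setT t ->
    `|partial1of2 f z t| <= M * `|k t|.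
  move=> _ _; rewrite partial1of2E; have [_ ->] := df z t.
  by rewrite normrM ler_wpM2r.
split.
  exact: (derivable_under_integral measurableT xI intf derf G0 iG dfG).
rewrite [LHS](differentiation_under_integral
  measurableT xI intf derf G0 iG dfG).
by apply: eq_Rintegral => t _; rewrite partial1of2E; have [_ ->] := df x t.
Qed.

Lemma smooth_correlation k phi (c d : R) : mu.-integrable setT (EFin \o k) ->
  smooth phi ->
  (forall x, x < c -> phi x = 0) -> (forall x, d < x -> phi x = 0) ->
  smooth (correlation k phi).
Proof.
move=> ik sphi phic phid; split=> n.
elim: n phi sphi phic phid => [|n ih] phi sphi phic phid x.
  exact: (derive_correlation _ ik sphi phic phid).1.
rewrite derive1Sn (_ : derive1 _ = correlation k (derive1 phi)).
  apply: ih; first exact: smooth_derive1.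
  - by move=> y; exact: derive1_eq0_lt phic.
  - by move=> y; exact: derive1_eq0_gt phid.
by apply/funext => y; exact: (derive_correlation _ ik sphi phic phid).2.
Qed.

End correlation.

(** * The truncated fractional kernel *)

Section frac_kernel.
Context {R : realType}.
Local Notation mu := (@lebesgue_measure R).
Context (alpha l : R).

(** The cut at [l] makes the kernel integrable on the line. For [l = b - a] it is invisible on []a,
    b[], where distances between points stay below [l]. *)
Definition frac_kernel : R -> R := (fun t => (t `^ alpha)^-1) \_ `]0, l[.

Lemma frac_kernel_ge0 t : 0 <= frac_kernel t.
Proof.
by rewrite /frac_kernel patchE; case: ifP => // _; rewrite invr_ge0 powR_ge0.
Qed.

Lemma measurable_frac_kernel : measurable_fun setT frac_kernel.
Proof.
apply: (iffLR (measurable_restrictT _ _)) => //; apply: measurable_funTS.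
exact: measurable_powR_inv.
Qed.

Lemma integrable_frac_kernel : alpha < 1 ->
  mu.-integrable setT (EFin \o frac_kernel).
Proof.
move=> alpha1; rewrite -restrict_EFin.
apply: (iffLR (integrable_mkcond _ _)) => //.
exact: integrable_powR_inv.
Qed.

(** This is where [alpha * p < 1] enters: the [p]-th power of the kernel has the same shape, with
    exponent [alpha * p]. *)
Lemma integrable_frac_kernel_powR (p : R) : 0 < p -> alpha * p < 1 ->
  mu.-integrable setT (EFin \o (fun t => frac_kernel t `^ p)).
Proof.
move=> p0 ap1.
rewrite (_ : (fun t => _) = (fun t => (t `^ (alpha * p))^-1) \_ `]0, l[).
  rewrite -restrict_EFin; apply: (iffLR (integrable_mkcond _ _)) => //.
  exact: integrable_powR_inv.
apply/funext => t; rewrite /frac_kernel !patchE; case: ifP => _.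
  by rewrite -powRN -powRrM mulNr powRN.
by rewrite powR0// gt_eqF.
Qed.

End frac_kernel.

(** * The right fractional derivative of a test function as the derivative of a correlation *)

Section right_frac_derive.
Context {R : realType}.
Local Notation mu := (@lebesgue_measure R).

(** The truncation of the kernel costs nothing when [a < z]: if [b - a <= t], then [z + t] lies
    beyond [b], where [phi] vanishes. *)
Lemma correlation_frac_kernelE (a b alpha z : R) (phi : R -> R) : a < b ->
  test_function `]a, b[ phi -> a < z ->
  \int[mu]_(y in `]z, +oo[) (phi y / (y - z) `^ alpha) =
  correlation (frac_kernel alpha (b - a)) phi z.
Proof.
move=> ab /(test_function_itvP _ ab)[sphi [c [d [ac db [phic phid]]]]] az.
rewrite Rintegral_mkcond -(Rintegral_shift z).
  apply: eq_Rintegral => t _.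
  rewrite /frac_kernel !patchE !mem_setE !in_itv/= andbT ltrDr addrK.
  rewrite [t + z]addrC; have [t0|t0] //= := ltP 0 t; last by rewrite mulr0.
  case: ltP => // lt; rewrite phid ?mul0r//.
  by apply: (lt_le_trans db); lra.
apply: (iffLR (measurable_restrictT _ _)) => //; apply: measurable_funTS.
apply: measurable_funM.
  by apply: continuous_measurable_fun; exact: smooth_continuous.
apply: (measurableT_comp (measurable_powR_inv alpha)).
exact: measurable_funB.
Qed.

Lemma right_frac_deriveE (a b alpha x : R) (phi : R -> R) : a < b ->
  test_function `]a, b[ phi -> a < x ->
  right_frac_derive alpha phi x = - (Gamma (1 - alpha))^-1 *
    derive1 (correlation (frac_kernel alpha (b - a)) phi) x.
Proof.
move=> ab tphi ax; congr (_ * _); apply: near_derive1; near=> z.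
by apply: correlation_frac_kernelE => //; near: z; exact: lt_nbhsr.
Unshelve. all: by end_near. Qed.

End right_frac_derive.

(** * Convolution of an integrable function with a p-integrable kernel *)

Section convolution.
Context {R : realType}.
Local Notation mu := (@lebesgue_measure R).
Implicit Types (f g h k : R -> R).

(* The graph of [t `^ p] lies above its tangent at [A]. *)
Lemma powR_tangent_le (p A t : R) : 1 <= p -> 0 < A -> 0 <= t ->
  p * A `^ (p - 1) * t - (p - 1) * A `^ p <= t `^ p.
Proof.
move=> p1 A0 t0; have p0 : 0 < p by exact: lt_le_trans p1.
have [->|pn1] := eqVneq p 1.
  by rewrite subrr powRr0 mul0r subr0 !mul1r powRr1.
have pp : 0 < p - 1 by rewrite subr_gt0 lt_neqAle eq_sym pn1.
(* The claim is [p] times Young's inequality for [t] and [A ^ (p - 1)] with these conjugate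
   exponents; they make sense only for [p > 1], hence the separate case above. *)
have pq : p^-1 + (p / (p - 1))^-1 = 1.
  by rewrite invf_div; field; rewrite gt_eqF.
have := @conjugate_powR _ t (A `^ (p - 1)) p (p / (p - 1)) t0 (powR_ge0 _ _) p0
  (divr_gt0 p0 pp) pq.
rewrite -powRrM (_ : (p - 1) * (p / (p - 1)) = p); last first.
  by field; rewrite gt_eqF.
rewrite invf_div => /(ler_wpM2l (ltW p0)).
rewrite mulrDr (_ : p * (t `^ p / p) = t `^ p); last by field; rewrite gt_eqF.
rewrite (_ : p * (A `^ p * ((p - 1) / p)) = (p - 1) * A `^ p); last first.
  by field; rewrite gt_eqF.
lra.
Qed.

(** The bound [h <= 1 + h ^ p] gives the dominating function. *)
Lemma integrableM_powR (p : R) g h : 1 <= p -> (forall x, 0 <= h x) ->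
  measurable_fun setT h -> mu.-integrable setT (EFin \o g) ->
  mu.-integrable setT (EFin \o (fun x => g x * h x `^ p)) ->
  mu.-integrable setT (EFin \o (fun x => g x * h x)).
Proof.
move=> p1 h0 mh ig ighp.
have mg := integrable_measurable_fun ig.
have isum : mu.-integrable setT
    (EFin \o (fun x => `|g x| + `|g x * h x `^ p|)).
  by apply: integrable_add => //; exact: integrable_norm.
apply: (le_integrable _ _ _ isum) => //.
  exact/measurable_EFinP/measurable_funM.
move=> x _; rewrite /= lee_fin !normrM (ger0_norm (h0 x)).
rewrite (ger0_norm (powR_ge0 _ _)) [leRHS]ger0_norm; last first.
  by rewrite addr_ge0// mulr_ge0// powR_ge0.
rewrite -{2}[`|g x|]mulr1 -mulrDr ler_wpM2l//.
have [h1|h1] := leP (h x) 1; first by rewrite ler_wpDr// powR_ge0.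
by rewrite ler_wpDl// le1r_powR// ltW.
Qed.

(** Jensen's inequality for the weight [g], with an upper bound [M] in place of its mass, which may
    be 0. The right-hand side is an extended real, so that it may be infinite. The proof integrates
    the tangent inequality against [g]. *)
Lemma jensen_powR (p M : R) g h : 1 <= p -> 0 < M ->
  (forall x, 0 <= g x) -> (forall x, 0 <= h x) ->
  measurable_fun setT h -> mu.-integrable setT (EFin \o g) ->
  \int[mu]_x g x <= M ->
  (((\int[mu]_x (g x * h x)) `^ p)%:E <=
   (M `^ (p - 1))%:E * \int[mu]_x (g x * h x `^ p)%:E)%E.
Proof.
move=> p1 M0 g0 h0 mh ig gM; have p0 : 0 < p by exact: lt_le_trans p1.
have mg := integrable_measurable_fun ig.
have ghp0 : (0 <= \int[mu]_x (g x * h x `^ p)%:E)%E.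
  by apply: integral_ge0 => x _; rewrite lee_fin mulr_ge0// powR_ge0.
have mhp : measurable_fun setT (fun x => h x `^ p).
  by apply: (measurableT_comp (measurable_powR p)).
have [Ioo|Ifin] := eqVneq (\int[mu]_x (g x * h x `^ p)%:E)%E +oo%E.
  by rewrite Ioo gt0_muley ?leey// lte_fin powR_gt0.
have ighp : mu.-integrable setT (EFin \o (fun x => g x * h x `^ p)).
  apply/integrableP; split; first exact/measurable_EFinP/measurable_funM.
  under eq_integral do rewrite gee0_abs ?lee_fin ?mulr_ge0 ?powR_ge0//.
  by rewrite ltey.
have igh : mu.-integrable setT (EFin \o (fun x => g x * h x)).
  exact: integrableM_powR ighp.
rewrite -(fineK (_ : \int[mu]_x (g x * h x `^ p)%:E \is a fin_num)%E); last first.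
  by rewrite ge0_fin_numE// ltey.
rewrite -EFinM lee_fin -[fine _]/(\int[mu]_x (g x * h x `^ p)).
set I := \int[mu]_x (g x * h x `^ p); set B := \int[mu]_x (g x * h x).
have B0 : 0 <= B by apply: Rintegral_ge0 => x _; rewrite mulr_ge0.
have I0 : 0 <= I by apply: Rintegral_ge0 => x _; rewrite mulr_ge0 ?powR_ge0.
have [B00|Bn0] := eqVneq B 0.
  by rewrite B00 powR0 ?gt_eqF// mulr_ge0// powR_ge0.
(* The point of tangency is the mean of [h], with [M] as the mass. It must be positive, whence the
   separate treatment of [B = 0]. *)
pose A := B / M; have A0 : 0 < A by rewrite divr_gt0// lt_neqAle eq_sym Bn0.
have : \int[mu]_x (p * A `^ (p - 1) * (g x * h x) +
    (- ((p - 1) * A `^ p)) * g x) <= I.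
  apply: le_Rintegral => //.
    by apply: integrable_add => //; exact: integrable_scale.
  move=> x _; rewrite mulNr mulrCA [X in _ - X]mulrC -mulrBr ler_wpM2l//.
  exact: powR_tangent_le.
rewrite RintegralD//; [|exact: integrable_scale..].
rewrite !RintegralZl// -/B => BI.
have BAM : B = A * M by rewrite /A mulfVK// gt_eqF.
have ApE : A * A `^ (p - 1) = A `^ p by rewrite mulr_powRB1// ltW.
have MpE : M * M `^ (p - 1) = M `^ p by rewrite mulr_powRB1// ltW.
(* The mass of [g] enters with the factor [- (p - 1) * A ^ p], which is at most 0, so it may be
   replaced by its upper bound [M]. *)
have AI : A `^ p * M <= I.
  apply: le_trans BI; rewrite BAM.
  have -> : p * A `^ (p - 1) * (A * M) = p * (A `^ p * M) by rewrite -ApE; ring.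
  have : (p - 1) * A `^ p * \int[mu]_x g x <= (p - 1) * A `^ p * M.
    by rewrite ler_wpM2l// mulr_ge0 ?powR_ge0// subr_ge0.
  lra.
rewrite BAM powRM ?(ltW A0) ?(ltW M0)// -MpE mulrCA mulrA [X in X <= _]mulrC.
by rewrite ler_wpM2l ?powR_ge0// mulrC.
Qed.

(** Once the order of integration is exchanged, the inner integral is that of a translate of [h] and
    does not depend on [x]. *)
Lemma tonelli_convolution g h :
  measurable_fun setT g -> measurable_fun setT h ->
  (forall x, 0 <= g x) -> (forall x, 0 <= h x) ->
  (\int[mu]_y \int[mu]_x (g x * h (y - x))%:E =
   \int[mu]_x (g x)%:E * \int[mu]_y (h y)%:E)%E.
Proof.
move=> mg mh g0 h0.
pose F (z : measurableTypeR R * measurableTypeR R) :=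
  (g z.1 * h (z.2 - z.1))%:E.
have mF : measurable_fun setT F.
  apply/measurable_EFinP/measurable_funM.
    exact: measurableT_comp.
  apply: measurableT_comp => //.
  by apply: measurable_funB; [exact: measurable_snd|exact: measurable_fst].
have F0 z : (0 <= F z)%E by rewrite lee_fin mulr_ge0.
rewrite -[LHS](@fubini_tonelli _ _ _ _ _ mu mu F mF F0) /=.
have h0' : (0 <= \int[mu]_y (h y)%:E)%E.
  by apply: integral_ge0 => x _; rewrite lee_fin.
rewrite -ge0_integralZr//; last 2 first.
  exact/measurable_EFinP.
  by move=> x _; rewrite lee_fin.
apply: eq_integral => x _; rewrite /fubini_F.
under eq_integral do rewrite /F/= EFinM.
rewrite ge0_integralZl ?lee_fin//; last 2 first.
- apply/measurable_EFinP; apply: measurableT_comp => //.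
  exact: measurable_funB.
- by move=> y _; rewrite lee_fin.
congr (_ * _)%E.
by rewrite (integral_shift (- x) (f := EFin \o h))//; exact/measurable_EFinP.
Qed.

Definition convolution g k y := \int[mu]_x (g x * k (y - x)).

Let conv_fun g k (z : measurableTypeR R * measurableTypeR R) :=
  (g z.1 * k (z.2 - z.1))%:E.

(** Tonelli's theorem for absolute values gives a product of two finite integrals. This yields the
    measurability of the convolution and permits the use of Fubini's theorem. *)
Lemma integrable_conv_fun g k :
  mu.-integrable setT (EFin \o g) -> mu.-integrable setT (EFin \o k) ->
  (mu \x mu)%E.-integrable setT (conv_fun g k).
Proof.
move=> ig ik.
have mg := integrable_measurable_fun ig.
have mk := integrable_measurable_fun ik.
have mF : measurable_fun setT (conv_fun g k).
  apply/measurable_EFinP/measurable_funM.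
    exact: measurableT_comp.
  apply: measurableT_comp => //.
  by apply: measurable_funB; [exact: measurable_snd|exact: measurable_fst].
apply/(integrable21ltyP mu mu mF).
rewrite [X in (X < _)%E](_ : _ = \int[mu]_x `|g x|%:E * \int[mu]_y `|k y|%:E)%E.
  rewrite lte_mul_pinfty ?integral_ge0//.
  - rewrite ge0_fin_numE ?integral_ge0//.
    by have /integrableP[] := ig.
  - by have /integrableP[] := ik.
rewrite -(tonelli_convolution (g := fun x => `|g x|) (h := fun x => `|k x|))//.
- apply: eq_integral => y _; apply: eq_integral => x _.
  by rewrite /conv_fun/= normrM.
- exact: measurableT_comp.
- exact: measurableT_comp.
Qed.

Lemma measurable_convolution g k :
  mu.-integrable setT (EFin \o g) -> mu.-integrable setT (EFin \o k) ->
  measurable_fun setT (convolution g k).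
Proof.
move=> ig ik.
have := measurable_fubini_G (integrable_conv_fun ig ik).
by move=> mG; exact: (measurableT_comp (f := fine) _ mG).
Qed.

(** Jensen's inequality with weight [|g|] bounds the [p]-th power of the convolution pointwise by a
    multiple of the convolution of [|g|] with [k ^ p], which Tonelli's theorem integrates. *)
Lemma integral_powR_convolution_lty (p : R) g k :
  1 <= p -> (forall x, 0 <= k x) ->
  mu.-integrable setT (EFin \o g) -> mu.-integrable setT (EFin \o k) ->
  mu.-integrable setT (EFin \o (fun t => k t `^ p)) ->
  (\int[mu]_y (`|convolution g k y| `^ p)%:E < +oo)%E.
Proof.
move=> p1 k0 ig ik ikp.
have mg := integrable_measurable_fun ig.
have mk := integrable_measurable_fun ik.
have p0 : 0 < p by exact: lt_le_trans p1.
have mkp : measurable_fun setT (fun t => k t `^ p).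
  exact: (measurableT_comp (measurable_powR p)).
have mky (y : R) : measurable_fun setT (fun x : R => k (y - x)).
  by apply: measurableT_comp => //; exact: measurable_funB.
have ing : mu.-integrable setT (EFin \o (fun x => `|g x|))
  by exact: integrable_norm.
(* The added 1 keeps [M] positive when [g] is 0 almost everywhere. *)
pose M := \int[mu]_x `|g x| + 1.
have M0 : 0 < M by rewrite ltr_wpDl// Rintegral_ge0.
(* [K] may be infinite at some points; the pointwise bound is trivial there. *)
pose K y := (\int[mu]_x (`|g x| * k (y - x) `^ p)%:E)%E.
have gkM y : ((`|convolution g k y| `^ p)%:E <= (M `^ (p - 1))%:E * K y)%E.
  have [Koo|Kfin] := eqVneq (K y) +oo%E.
    by rewrite Koo gt0_muley ?leey// lte_fin powR_gt0.
  have ingk : mu.-integrable setT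
      (EFin \o (fun x => `|g x| * k (y - x) `^ p)).
    apply/integrableP; split.
      apply/measurable_EFinP/measurable_funM; first exact: measurableT_comp.
      exact: (measurableT_comp mkp (measurable_funB _ _)).
    under eq_integral do rewrite gee0_abs ?lee_fin ?mulr_ge0 ?powR_ge0//.
    by rewrite ltey.
  have igk : mu.-integrable setT (EFin \o (fun x => g x * k (y - x))).
    have := integrableM_powR p1 (fun x => k0 (y - x)) (mky y) ing ingk.
    apply: le_integrable => //.
      apply/measurable_EFinP; apply: measurable_funM; [exact: mg|exact: mky].
    by move=> x _; rewrite /= !normrM normr_id.
  apply: le_trans (jensen_powR p1 M0 _ _ (mky y) ing _); last 3 first.
  - by [].
  - by [].
  - by rewrite lerDl.
  rewrite lee_fin ge0_ler_powR ?nnegrE ?(ltW p0)//.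
    by rewrite Rintegral_ge0// => x _; rewrite mulr_ge0.
  rewrite (le_trans (le_normr_Rintegral _ igk))//.
  by under eq_Rintegral do rewrite normrM (ger0_norm (k0 _)).
have mK : measurable_fun setT K.
  apply: (@measurable_fun_fubini_tonelli_G _ _ _ _ _ mu
    (fun z : measurableTypeR R * measurableTypeR R =>
      (`|g z.1| * k (z.2 - z.1) `^ p)%:E)).
    apply/measurable_EFinP/measurable_funM.
      by apply: measurableT_comp => //; exact: measurableT_comp.
    apply: (measurableT_comp mkp).
    by apply: measurable_funB; [exact: measurable_snd|exact: measurable_fst].
  by move=> z; rewrite lee_fin mulr_ge0// powR_ge0.
have mc := measurable_convolution ig ik.
have K0 y : (0 <= K y)%E.
  by apply: integral_ge0 => x _; rewrite lee_fin mulr_ge0// powR_ge0.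
apply: (@le_lt_trans _ _ (\int[mu]_y ((M `^ (p - 1))%:E * K y))%E).
  apply: ge0_le_integral => //.
  - apply/measurable_EFinP; apply: (measurableT_comp (measurable_powR p)).
    exact: measurableT_comp.
  - exact: measurable_funeM.
rewrite ge0_integralZl ?lee_fin ?powR_ge0//.
rewrite /K (tonelli_convolution (g := fun x => `|g x|)
  (h := fun x => k x `^ p))//; last 2 first.
- exact: measurableT_comp.
- by move=> x; rewrite powR_ge0.
have fin (f : R -> R) : mu.-integrable setT (EFin \o f) ->
    (\int[mu]_x (f x)%:E)%E \is a fin_num.
  by move=> fi; exact: integrable_fin_num.
rewrite lte_mul_pinfty ?lee_fin ?powR_ge0// ltey_eq fin_numM//; exact: fin.
Qed.

End convolution.

(** * Membership in Lp, and Fubini's theorem for convolutions *)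

Section Lp_fubini.
Context {R : realType}.
Local Notation mu := (@lebesgue_measure R).
Implicit Types (D : set R) (u v f g k phi : R -> R) (p : R).

Lemma LpP D p u : measurable D -> 0 < p -> Lp D p u <->
  measurable_fun D u /\ (\int[mu]_(x in D) (`|u x| `^ p)%:E < +oo)%E.
Proof.
move=> mD p0.
have E : (\int[mu]_x (`|(u \_ D) x| `^ p)%:E =
    \int[mu]_(x in D) (`|u x| `^ p)%:E)%E.
  rewrite [RHS]integral_mkcond; apply: eq_integral => x _.
  by rewrite !patchE; case: ifP => // _; rewrite normr0 powR0// gt_eqF.
split.
- move=> /andP[/[!inE]/= mu_ fu]; split.
    by apply: (iffRL (measurable_restrictT _ _)).
  rewrite -E; move: fu => /(poweR_lty p).
  by rewrite powR_Lnorm ?gt_eqF.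
- move=> [mu_ fu]; apply/andP; split; rewrite inE/=.
    by apply: (iffLR (measurable_restrictT _ _)).
  rewrite /finite_norm unlock /Lnorm poweR_lty//=.
  by move: fu; rewrite -E.
Qed.

(** On a bounded interval [1 + |u| ^ p] is integrable, and it dominates [|u|]. *)
Lemma Lp_integrable (a b p : R) u : 1 <= p -> Lp `]a, b[ p u ->
  mu.-integrable `]a, b[ (EFin \o u).
Proof.
move=> p1 /LpP[//||mu_ fu]; first exact: lt_le_trans p1.
have iup : mu.-integrable `]a, b[ (EFin \o (fun x => `|u x| `^ p)).
  apply/integrableP; split.
    apply/measurable_EFinP; apply: (measurableT_comp (measurable_powR p)).
    exact: measurableT_comp.
  by under eq_integral do rewrite /= ger0_norm ?powR_ge0//.
have i1 : mu.-integrable `]a, b[ (EFin \o (fun=> 1)).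
  apply: (@integrableS _ _ _ mu [set` `[a, b]]) => //.
    exact: subset_itv_oo_cc.
  apply: continuous_compact_integrable; first exact: segment_compact.
  by apply: continuous_subspaceT => x; exact: cvg_cst.
have := integrable_add (measurable_itv _) i1 iup.
apply: le_integrable => //; first exact/measurable_EFinP.
move=> x _; rewrite /= lee_fin [leRHS]ger0_norm ?addr_ge0 ?powR_ge0//.
have [u1|u1] := leP `|u x| 1; first by rewrite ler_wpDr// powR_ge0.
by rewrite ler_wpDl// le1r_powR// ltW.
Qed.

Lemma integrable_shift k (c : R) : mu.-integrable setT (EFin \o k) ->
  mu.-integrable setT (EFin \o (fun y => k (y - c))).
Proof.
move=> ik; have mk : measurable_fun setT (EFin \o k)
  by exact: measurable_int ik.
apply/integrableP; split.
  apply/measurable_EFinP; apply: measurableT_comp; first exact/measurable_EFinP.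
  exact: measurable_funB.
rewrite (integral_shift (- c) (f := fun y => `|(k y)%:E|%E)).
  by have /integrableP[] := ik.
exact: measurableT_comp.
Qed.

(** Correlation with [k] is the adjoint of convolution with [k]; this carries the kernel from the
    weak derivative over to the test function. *)
Lemma fubini_convolution g k phi M : continuous phi ->
  (forall x, `|phi x| <= M) ->
  mu.-integrable setT (EFin \o g) -> mu.-integrable setT (EFin \o k) ->
  \int[mu]_y (convolution g k y * phi y) =
  \int[mu]_x (g x * correlation k phi x).
Proof.
move=> cphi phiM ig ik.
have mg := integrable_measurable_fun ig.
have mk := integrable_measurable_fun ik.
have mphi : measurable_fun setT phi by exact: continuous_measurable_fun.
have M0 : 0 <= M by exact: le_trans (phiM 0).
pose F (z : measurableTypeR R * measurableTypeR R) :=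
  (g z.1 * k (z.2 - z.1) * phi z.2)%:E.
have igk := integrable_conv_fun ig ik.
have iF : (mu \x mu)%E.-integrable setT F.
  apply: (le_integrable measurableT _ _ (integrableZl measurableT M igk)) => //.
    apply/measurable_EFinP; apply: measurable_funM.
      by apply/measurable_EFinP; exact: measurable_int igk.
    exact: measurableT_comp.
  move=> z _; rewrite /F /= lee_fin !normrM (ger0_norm M0) mulrC.
  by rewrite ler_wpM2r// mulr_ge0.
have FE := Fubini iF.
rewrite /Rintegral; congr fine.
transitivity (\int[mu]_y \int[mu]_x F (x, y))%E.
  apply: ae_eq_integral => //.
  - apply/measurable_EFinP; apply: measurable_funM => //.
    exact: measurable_convolution.
  - exact: (measurable_fubini_G iF).
  (* Only for almost every [y] is the integrand of the convolution integrable; elsewhere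
     [convolution g k y] is a default value. *)
  - apply: filterS (ae_integrable2 igk) => y iy _.
    rewrite (_ : \int[mu]_x F (x, y) =
        \int[mu]_x ((phi y)%:E * (g x * k (y - x))%:E))%E; last first.
      by apply: eq_integral => x _; rewrite /F/= mulrC EFinM.
    rewrite integralZl// mulrC EFinM; congr (_ * _)%E.
    by rewrite /convolution /Rintegral fineK//; exact: integrable_fin_num iy.
rewrite -FE; apply: eq_integral => x _.
have ikx : mu.-integrable setT (EFin \o (fun y => k (y - x))).
  exact: integrable_shift.
have iphik : mu.-integrable setT (EFin \o ((fun y => k (y - x)) \* phi)).
  exact: (integrableM_bounded _ ikx mphi (fun x _ => phiM x)).
rewrite (_ : \int[mu]_y F (x, y) =
    \int[mu]_y ((g x)%:E * (k (y - x) * phi y)%:E))%E; last first.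
  by apply: eq_integral => y _; rewrite /F/= -mulrA EFinM.
rewrite integralZl// EFinM; congr (_ * _)%E.
rewrite correlationE// /Rintegral fineK.
  by apply: eq_integral => y _; rewrite mulrC.
apply: integrable_fin_num => //; move: iphik; congr (_.-integrable _ _).
by apply/funext => y; rewrite /= mulrC.
Qed.

End Lp_fubini.

(** * The left fractional derivative *)

Section sobolev_left.
Context {R : realType}.
Local Notation mu := (@lebesgue_measure R).
Implicit Types (D : set R) (u v f g k phi : R -> R) (p : R).

Lemma Lp_sub D p u : measurable D -> 0 < p -> Lp setT p u -> Lp D p u.
Proof.
move=> mD p0 /(LpP _ measurableT p0)[mu_ fu]; apply/(LpP _ mD p0).
split; first exact: measurable_funTS.
apply: le_lt_trans fu; apply: ge0_subset_integral => //.
apply/measurable_EFinP; apply: (measurableT_comp (measurable_powR p)).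
exact: measurableT_comp.
Qed.

Lemma Lp_linear_combination (p r s : R) f g : 1 <= p ->
  Lp setT p f -> Lp setT p g -> Lp setT p (fun x => r * f x + s * g x).
Proof.
rewrite /Lp/= !patch_setT => p1 Lf Lg.
have [_ add] := @Lfun_addr_closed _ _ R mu p%:E p1.
rewrite (_ : (fun x => _) = r \o* f + s \o* g).
  exact: add (Lfun_scale r p1 Lf) (Lfun_scale s p1 Lg).
by apply/funext => x; rewrite [r * _]mulrC [s * _]mulrC.
Qed.

Lemma Lp1 (a b p : R) u : 1 <= p -> Lp `]a, b[ p u -> Lp `]a, b[ 1 u.
Proof.
move=> p1 Lu; have /integrableP[mu_ fu] := Lp_integrable p1 Lu.
apply/(LpP _ (measurable_itv _) ltr01); split; first exact/measurable_EFinP.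
by under eq_integral do rewrite powRr1//.
Qed.

Lemma Lp_frac_kernel_shift (alpha l c p : R) : 0 < p -> alpha * p < 1 ->
  Lp setT p (fun y => frac_kernel alpha l (y - c)).
Proof.
move=> p0 ap; apply/(LpP _ measurableT p0); split.
  apply: measurableT_comp; first exact: measurable_frac_kernel.
  exact: measurable_funB.
have /integrableP[_] :=
  integrable_shift c (integrable_frac_kernel_powR l p0 ap).
by under eq_integral do rewrite /= norm_powR ?frac_kernel_ge0//.
Qed.

(** The kernel lives on positive [t], so the correlation at [z] only sees [phi] on the right of
    [z]. *)
Lemma correlation_eq0 alpha l phi (d z : R) :
  (forall x, d < x -> phi x = 0) -> d < z ->
  correlation (frac_kernel alpha l) phi z = 0.
Proof.
move=> phid dz; rewrite /correlation -[RHS](@Rintegral_set0 _ _ _ mu (fun=> 0)).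
rewrite [RHS]Rintegral_mkcond; apply: eq_Rintegral => t _.
rewrite patchE in_set0 /frac_kernel patchE mem_setE in_itv/=.
have [t0|t0] /= := ltP 0 t; last by rewrite mulr0.
by rewrite phid ?mul0r// (lt_trans dz)// ltrDl.
Qed.

Lemma weak_derive_correlation (a b alpha : R) u v : a < b -> alpha < 1 ->
  mu.-integrable `]a, b[ (EFin \o u) -> mu.-integrable `]a, b[ (EFin \o v) ->
  weak_derive `]a, b[ u v ->
  exists C, forall phi, test_function `]a, b[ phi ->
    let G := correlation (frac_kernel alpha (b - a)) phi in
    \int[mu]_(x in `]a, b[) (u x * derive1 G x) +
    \int[mu]_(x in `]a, b[) (v x * G x) = C * G a.
Proof.
move=> ab alpha1 iu iv [_ _ uv].
(* The cutoff is built from a nonzero test function; without one, there is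
   nothing to prove. *)
have [[phi0 [x0 [tphi0 phi0x0]]]|no_test] :=
    pselect (exists phi0 x0, test_function `]a, b[ phi0 /\ phi0 x0 != 0).
  have [C HC] := weak_derive_boundary ab iu iv uv tphi0 phi0x0.
  exists C => phi /(test_function_itvP _ ab)[sphi [c [d [_ db [phic phid]]]]].
  apply: (HC _ d db); last by move=> x; exact: correlation_eq0.
  exact: smooth_correlation (integrable_frac_kernel _ alpha1) sphi phic phid.
exists 0 => phi tphi G.
have phi0 x : phi x = 0.
  by apply: contrapT => /eqP phix; apply: no_test; exists phi, x.
have G0 : G = fun=> 0.
  apply/funext => z; apply: (@correlation_eq0 _ _ _ (z - 1)) => //.
  by rewrite ltrBlDr ltrDl.
have I0 f : \int[mu]_(x in `]a, b[) (f x * 0) = 0.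
  by under eq_Rintegral do rewrite mulr0; rewrite Rintegral_cst// mul0r.
by under eq_Rintegral do rewrite G0 derive1_cst; rewrite G0 !I0 mul0r addr0.
Qed.

Lemma sobolev1_left_frac (a b alpha p : R) : a < b -> alpha < 1 -> 1 <= p ->
  alpha * p < 1 ->
  sobolev1 `]a, b[ p `<=` left_frac_sobolev `]a, b[ alpha p.
Proof.
move=> ab alpha1 p1 ap u [Lu [v uv Lv]]; split=> //.
have p0 : 0 < p by exact: lt_le_trans p1.
have iu := Lp_integrable p1 Lu; have iv := Lp_integrable p1 Lv.
have [C HC] := weak_derive_correlation ab alpha1 iu iv uv.
set k := frac_kernel alpha (b - a) in HC.
have ik : mu.-integrable setT (EFin \o k) by exact: integrable_frac_kernel.
have mk : measurable_fun setT k by exact: measurable_frac_kernel.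
pose V := v \_ `]a, b[.
have iV : mu.-integrable setT (EFin \o V).
  by rewrite /V -restrict_EFin; apply: (iffLR (integrable_mkcond _ _)).
pose c := (Gamma (1 - alpha))^-1.
(* Tested against [phi], the convolution yields the integral of [v * G], and [k (y - a)] yields
   [G a]; the coefficients are those that the boundary identity requires. *)
pose w y := c * convolution V k y + (- c * C) * k (y - a).
have LcV : Lp setT p (convolution V k).
  apply/(LpP _ measurableT p0); split; first exact: measurable_convolution.
  apply: integral_powR_convolution_lty => //; first exact: frac_kernel_ge0.
  exact: integrable_frac_kernel_powR.
have Lka : Lp setT p (fun y => k (y - a)) by exact: Lp_frac_kernel_shift.
have Lw : Lp `]a, b[ p w.
  by apply: Lp_sub => //; exact: Lp_linear_combination.
exists w => //; split; first exact: Lp1 Lu.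
  apply: open_integrable_locally; first exact: interval_open.
  exact: Lp_integrable Lw.
move=> phi tphi; have := HC _ tphi; set G := correlation k phi => /= HG.
have [sphi [c0 [d [ac0 db [phic phid]]]]] := (test_function_itvP _ ab).1 tphi.
have cphi := smooth_continuous sphi.
have mphi : measurable_fun setT phi by exact: continuous_measurable_fun.
have [M M0 phiM] := bounded_continuous_support cphi phic phid.
have phi_out (f : R -> R) : \int[mu]_(y in `]a, b[) (f y * phi y) =
    \int[mu]_y (f y * phi y).
  rewrite Rintegral_mkcond; apply: eq_Rintegral => y _.
  rewrite patchE; case: ifPn => //; rewrite notin_setE/= in_itv/= => /negP.
  rewrite negb_and -!leNgt => /orP[ya|yb].
    by rewrite phic ?mulr0// (le_lt_trans ya).
  by rewrite phid ?mulr0// (lt_le_trans db).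
have sG : smooth G by exact: smooth_correlation ik sphi phic phid.
have icphi : mu.-integrable `]a, b[ (EFin \o (convolution V k \* phi)).
  apply: integrableM_continuous => //.
  by apply: Lp_integrable p1 _; exact: Lp_sub.
have ikphi : mu.-integrable `]a, b[ (EFin \o ((fun y => k (y - a)) \* phi)).
  apply: integrableM_continuous => //.
  by apply: Lp_integrable p1 _; exact: Lp_sub.
have iuG : mu.-integrable `]a, b[ (EFin \o (u \* derive1 G)).
  apply: integrableM_continuous => //.
  exact/smooth_continuous/smooth_derive1.
transitivity (c * (\int[mu]_(x in `]a, b[) (v x * G x)) + (- c * C) * G a).
  transitivity (\int[mu]_(y in `]a, b[) (c * (convolution V k y * phi y) +
      (- c * C) * (k (y - a) * phi y))).
    by apply: eq_Rintegral => y _; rewrite /w; ring.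
  rewrite RintegralD//; [|exact: integrable_scale..].
  rewrite !RintegralZl//; congr (_ * _ + _ * _).
    rewrite (phi_out (convolution V k)) (fubini_convolution cphi phiM iV ik).
    rewrite [RHS]Rintegral_mkcond; apply: eq_Rintegral => x _.
    by rewrite /V !patchE; case: ifP; rewrite ?mul0r.
  rewrite (phi_out (fun y => k (y - a))) /G correlationE//.
  by apply: eq_Rintegral => y _; rewrite mulrC.
(* The boundary identity [HG] trades [v] and [C] for [u]. *)
transitivity (- c * \int[mu]_(x in `]a, b[) (u x * derive1 G x)).
  move/eqP : HG; rewrite addrC eq_sym -subr_eq => /eqP <-.
  ring.
transitivity (\int[mu]_(x in `]a, b[) (- c * (u x * derive1 G x))).
  by rewrite [RHS]RintegralZl.
apply: eq_Rintegral => x.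
rewrite inE/= in_itv/= => /andP[ax _].
rewrite (right_frac_deriveE _ ab tphi ax).
by rewrite [RHS]mulrCA.
Qed.

End sobolev_left.

(** * Reflection and the right fractional derivative *)

Section reflection.
Context {R : realType}.
Local Notation mu := (@lebesgue_measure R).
Implicit Types (a b alpha p : R) (f u v phi : R -> R).

Lemma measurable_reflection a b f : measurable_fun `]a, b[ f ->
  measurable_fun `]- b, - a[ (fun x => f (- x)).
Proof.
move=> mf; apply: (measurable_comp _ _ mf) => //.
by move=> _ [x /= + <-]; rewrite !in_itv/= andbC ltrNl ltrNr.
Qed.

Lemma integral_reflection a b (f : R -> \bar R) :
  measurable_fun `]- b, - a[ f ->
  (\int[mu]_(x in `]a, b[) f (- x)%R =
   \int[mu]_(x in `](- b)%R, (- a)%R[) f x)%E.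
Proof.
move=> mf; rewrite integral_mkcond [RHS]integral_mkcond.
rewrite -[RHS]lebesgue_integral_opp.
  apply: eq_integral => x _.
  by rewrite !patchE !mem_setE !in_itv/= !ltrN2 andbC.
by apply: (iffLR (measurable_restrictT _ _)).
Qed.

Lemma Rintegral_reflection a b f : measurable_fun `]- b, - a[ f ->
  \int[mu]_(x in `]a, b[) f (- x) = \int[mu]_(x in `]- b, - a[) f x.
Proof.
move=> mf; congr fine; apply: (integral_reflection (f := EFin \o f)).
exact/measurable_EFinP.
Qed.

Lemma Lp_reflection a b p u : 1 <= p -> Lp `]a, b[ p u ->
  Lp `]- b, - a[ p (fun x => u (- x)).
Proof.
move=> p1; have p0 : 0 < p by exact: lt_le_trans p1.
move=> /(LpP _ (measurable_itv _) p0)[mu_ fu].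
apply/(LpP _ (measurable_itv _) p0); split; first exact: measurable_reflection.
rewrite (integral_reflection (f := fun x => (`|u x| `^ p)%:E)) ?opprK//.
apply/measurable_EFinP; apply: (measurableT_comp (measurable_powR p)).
exact: measurableT_comp.
Qed.

Lemma derive1_reflection f x : derivable f (- x) 1 ->
  derive1 (fun z => f (- z)) x = - derive1 f (- x).
Proof.
move=> df; have := @derive1_comp_affine _ f (-1) 0 x.
rewrite mulN1r addr0 => /(_ df); rewrite mulrN1 => <-.
by congr derive1; apply/funext => z; rewrite mulN1r addr0.
Qed.

Lemma test_function_reflection a b phi : a < b -> test_function `]a, b[ phi ->
  test_function `]- b, - a[ (fun x => phi (- x)).
Proof.
move=> ab /(test_function_itvP _ ab)[sphi [c [d [ac db [phic phid]]]]].
apply/test_function_itvP; first by rewrite ltrN2.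
split.
  rewrite (_ : (fun x => _) = fun x => phi (-1 * x + 0)).
    exact: smooth_affine.
  by apply/funext => x; rewrite mulN1r addr0.
exists (- d), (- c); rewrite !ltrN2; split=> //.
by split=> x xcd; [apply: phid|apply: phic]; lra.
Qed.

Lemma Lp_locally_integrable a b p u : 1 <= p -> Lp `]a, b[ p u ->
  locally_integrable `]a, b[ u.
Proof.
move=> p1 Lu; apply: open_integrable_locally; first exact: interval_open.
exact: Lp_integrable Lu.
Qed.

(** The chain rule makes [- v (- x)] the weak derivative; the original identity is tested against
    the reflected test function. *)
Lemma sobolev1_reflection a b p u : a < b -> 1 <= p -> sobolev1 `]a, b[ p u ->
  sobolev1 `]- b, - a[ p (fun x => u (- x)).
Proof.
move=> ab p1 [Lu [v [_ _ uv] Lv]].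
have p0 : 0 < p by exact: lt_le_trans p1.
have [mu_ _] := (LpP _ (measurable_itv _) p0).1 Lu.
have [mv _] := (LpP _ (measurable_itv _) p0).1 Lv.
have Lru := Lp_reflection p1 Lu.
have Lrv : Lp `]- b, - a[ p (fun x => - v (- x)).
  have /(LpP _ (measurable_itv _) p0)[mrv frv] := Lp_reflection p1 Lv.
  apply/(LpP _ (measurable_itv _) p0); split; first exact: measurableT_comp.
  by under eq_integral do rewrite normrN.
split=> //; exists (fun x => - v (- x)) => //.
split; [exact: Lp_locally_integrable Lru|exact: Lp_locally_integrable Lrv|].
move=> phi tphi; have ba : - b < - a by rewrite ltrN2.
have [sphi _] := (test_function_itvP _ ba).1 tphi.
have trphi := test_function_reflection ba tphi; rewrite !opprK in trphi.
have mD f g : measurable_fun `]- b, - a[ f -> continuous g ->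
    measurable_fun `]- b, - a[ (f \* g).
  move=> mf cg; apply: measurable_funM => //; apply: measurable_funTS.
  exact: continuous_measurable_fun.
rewrite -(Rintegral_reflection
  (f := fun x => u (- x) * derive1 phi x)); last first.
  apply: mD; first exact: measurable_reflection.
  exact/smooth_continuous/smooth_derive1.
rewrite -(Rintegral_reflection (f := fun x => - v (- x) * phi x)); last first.
  apply: mD; last exact: smooth_continuous.
  by apply: measurableT_comp => //; exact: measurable_reflection.
have iv := Lp_integrable p1 Lv; have iu := Lp_integrable p1 Lu.
have crphi : continuous (fun x => phi (- x)).
  by have [/smooth_continuous] := (test_function_itvP _ ab).1 trphi.
have crdphi : continuous (derive1 (fun x => phi (- x))).
  by have [/smooth_derive1/smooth_continuous] := (test_function_itvP _ ab).1 trphi.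
transitivity (\int[mu]_(x in `]a, b[)
  (-1 * (u x * derive1 (fun z => phi (- z)) x))).
  apply: eq_Rintegral => x _; rewrite opprK derive1_reflection; last first.
    exact: smooth_derivable.
  by rewrite mulN1r mulrN opprK.
transitivity (- \int[mu]_(x in `]a, b[) (-1 * (v x * phi (- x)))); last first.
  by congr (- _); apply: eq_Rintegral => x _; rewrite opprK mulN1r mulNr.
rewrite !RintegralZl//.
- by rewrite uv// mulN1r mulN1r.
- exact: integrableM_continuous.
- exact: integrableM_continuous.
Qed.

(** Reflection exchanges the two half-lines of integration, and the minus sign in the right
    derivative absorbs the one from the chain rule. *)
Lemma left_frac_derive_reflection a b alpha phi x : a < b -> alpha < 1 ->
  test_function `]a, b[ phi -> x < b ->
  left_frac_derive alpha phi x =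
  right_frac_derive alpha (fun y => phi (- y)) (- x).
Proof.
move=> ab alpha1 tphi xb; have ba : - b < - a by rewrite ltrN2.
have trphi := test_function_reflection ab tphi.
have [srphi [c [d [_ _ [rphic rphid]]]]] := (test_function_itvP _ ba).1 trphi.
have cphi := smooth_continuous ((test_function_itvP _ ab).1 tphi).1.
have xb' : - b < - x by rewrite ltrN2.
(* Passing to the smooth function [G] supplies the derivability at [- x] that the chain rule asks
   for. *)
rewrite (right_frac_deriveE _ ba trphi xb').
set k := frac_kernel _ _; set G := correlation k _.
have sG : smooth G.
  exact: smooth_correlation (integrable_frac_kernel _ alpha1) srphi rphic rphid.
rewrite mulNr -mulrN; congr (_ * _).
have dG : derivable G (- x) 1 by exact: smooth_derivable.
rewrite -(derive1_reflection dG).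
apply: near_derive1; near=> z.
have zb : - b < - z by rewrite ltrN2; near: z; exact: lt_nbhsl.
rewrite -[RHS](correlation_frac_kernelE _ ba trphi zb).
rewrite Rintegral_mkcond [RHS]Rintegral_mkcond -[RHS]Rintegral_opp.
  apply: eq_Rintegral => y _.
  rewrite !patchE !mem_setE !in_itv/= andbT ltrN2 opprK; case: ifP => // _.
  by rewrite opprK addrC.
apply: (iffLR (measurable_restrictT _ _)) => //; apply: measurable_funTS.
apply: measurable_funM.
  exact: continuous_measurable_fun (smooth_continuous srphi).
apply: (measurableT_comp (measurable_powR_inv alpha)).
exact: measurable_funB.
Unshelve. all: by end_near. Qed.

Lemma left_frac_sobolev_reflection a b alpha p u : a < b -> alpha < 1 ->
  1 <= p -> Lp `]a, b[ p u ->
  left_frac_sobolev `]- b, - a[ alpha p (fun x => u (- x)) ->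
  right_frac_sobolev `]a, b[ alpha p u.
Proof.
move=> ab alpha1 p1 Lu [_ [w [_ _ uw] Lw]]; split=> //.
have ba : - b < - a by rewrite ltrN2.
have p0 : 0 < p by exact: lt_le_trans p1.
have Lrw := Lp_reflection p1 Lw; rewrite !opprK in Lrw.
exists (fun x => w (- x)) => //.
split; [exact: Lp1 Lu|exact: Lp_locally_integrable Lrw|].
move=> phi tphi; have trphi := test_function_reflection ab tphi.
have [srphi [c [d [_ _ [rphic rphid]]]]] := (test_function_itvP _ ba).1 trphi.
have [mu_ _] := (LpP _ (measurable_itv _) p0).1 Lu.
have [mw _] := (LpP _ (measurable_itv _) p0).1 Lw.
transitivity (\int[mu]_(x in `]- b, - a[) (w x * phi (- x))).
  rewrite -Rintegral_reflection.
    by apply: eq_Rintegral => x _; rewrite opprK.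
  apply: measurable_funM => //; apply: measurable_funTS.
  exact: continuous_measurable_fun (smooth_continuous srphi).
rewrite (uw _ trphi).
(* [h] agrees with the right fractional derivative on []- b, - a[] and is measurable on the whole
   line, so the integral can be reflected. *)
pose h x := - (Gamma (1 - alpha))^-1 *
  derive1 (correlation (frac_kernel alpha (- a - - b)) (fun x => phi (- x))) x.
have mh : measurable_fun setT h.
  apply: measurable_funM => //; apply: continuous_measurable_fun.
  apply/smooth_continuous/smooth_derive1.
  exact: smooth_correlation (integrable_frac_kernel _ alpha1) srphi rphic rphid.
transitivity (\int[mu]_(x in `]- b, - a[) (u (- x) * h x)).
  apply: eq_Rintegral => x; rewrite inE/= in_itv/= => /andP[bx _].
  by rewrite (right_frac_deriveE _ ba trphi bx).
rewrite -Rintegral_reflection.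
  apply: eq_Rintegral => x; rewrite inE/= in_itv/= => /andP[_ xb].
  rewrite opprK (left_frac_derive_reflection ab alpha1 tphi xb).
  have xb' : - b < - x by rewrite ltrN2.
  by rewrite (right_frac_deriveE _ ba trphi xb').
apply: measurable_funM; first exact: measurable_reflection.
exact: measurable_funTS.
Qed.

Lemma sobolev1_right_frac a b alpha p : a < b -> alpha < 1 -> 1 <= p ->
  alpha * p < 1 ->
  sobolev1 `]a, b[ p `<=` right_frac_sobolev `]a, b[ alpha p.
Proof.
move=> ab alpha1 p1 ap u su.
apply: left_frac_sobolev_reflection => //; first by case: su.
apply: sobolev1_left_frac => //; first by rewrite ltrN2.
exact: sobolev1_reflection.
Qed.

End reflection.

Unset Implicit Arguments.

Theorem theorem4p37 (R : realType) (a b alpha p : R)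
    (hab : a < b) (halpha0 : 0 < alpha) (halpha1 : alpha < 1)
    (hp : 1 <= p) (halphap : alpha * p < 1) :
  [/\ sobolev1 `]a, b[ p `<=` left_frac_sobolev `]a, b[ alpha p,
      sobolev1 `]a, b[ p `<=` right_frac_sobolev `]a, b[ alpha p &
      sobolev1 `]a, b[ p `<=` frac_sobolev `]a, b[ alpha p].
Proof.
have left : sobolev1 `]a, b[ p `<=` left_frac_sobolev `]a, b[ alpha p.
  exact: sobolev1_left_frac.
have right : sobolev1 `]a, b[ p `<=` right_frac_sobolev `]a, b[ alpha p.
  exact: sobolev1_right_frac.
by split=> // u su; split; [exact: left|exact: right].
Qed.
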